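(* Let $K\ge1$ and $k=\frac{K-1}{K+1}\in[0,1)$. Suppose that $f(z)=h(z)+\overline{g(z)}=\sum_{n=0}^\infty a_nz^n+\overline{\sum_{n=1}^\infty b_nz^n}$ is a sense-preserving $K$-quasiconformal harmonic mapping of the disk $\mathbb{D}$, where $|h(z)|<1$ in $\mathbb{D}$, and let $a=|a_0|$, so $0\le a<1$. Put $$\alpha_k=\frac{\sqrt{k^2+12k+12}-(2k+3)}{k+1},\qquad r_{a,k}=\frac{B_{a,k}-(k+2)(1+a)}{2a^2(k+1)+2ak},$$ where $$B_{a,k}=\sqrt{a^2(k^2+8k+8)+2a(k^2+6k+4)+(k+2)^2}.$$ If $a\ge\alpha_k$, then $$|h(z)|+\sum_{n=1}^\infty|a_n|r^n+\sum_{n=1}^\infty|b_n|r^n\le 1\quad\text{for all } |z|=r\le r_{a,k}.$$ The radius $r_{a,k}$ is sharp, i.e. for each $K\geq 1$ and $a\in[\alpha_k,1)$ the number $r_{a,k}$ cannot be replaced by any larger number so that the inequality remains true for all such $f$ with $|a_0|=a$.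
   Context: $\mathbb{D}=\{z\in\mathbb{C}:|z|<1\}$. A harmonic mapping in $\mathbb{D}$ is a complex-valued function $f$ with $\Delta f=4f_{z\overline z}=0$; it has a canonical representation $f=h+\overline g$ with $h,g$ analytic in $\mathbb{D}$ and $f(0)=h(0)$ (so $g(0)=0$). It is sense-preserving if $|h'|^2-|g'|^2>0$ in $\mathbb{D}$. A sense-preserving homeomorphism $f$ from $\mathbb{D}$ onto a domain, belonging to the Sobolev class $W^{1,2}_{loc}(\mathbb{D})$, is $K$-quasiconformal ($K\ge1$) if $\frac{|f_z|+|f_{\overline z}|}{|f_z|-|f_{\overline z}|}\le K$ in $\mathbb{D}$, i.e. for harmonic $f=h+\overline g$, $|g'(z)/h'(z)|\le k=\frac{K-1}{K+1}$ in $\mathbb{D}$. *)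

(* Defs.v *)
From Stdlib Require Export Reals.
From Coquelicot Require Export Coquelicot.

Open Scope R_scope.

Definition disk (z : C) : Prop := Cmod z < 1.

(** ** Real partial derivatives and harmonicity of complex-valued functions *)

(** A point [z : C] is the pair [(x, y)] with [z = x + iy]. *)
Definition partial_x (f : C -> C) (z : C) : C :=
  (Derive (fun t => Re (f (t, Im z))) (Re z),
   Derive (fun t => Im (f (t, Im z))) (Re z)).

Definition partial_y (f : C -> C) (z : C) : C :=
  (Derive (fun t => Re (f (Re z, t))) (Im z),
   Derive (fun t => Im (f (Re z, t))) (Im z)).

(** [Derive] is total, so existence of the partial derivatives has to be
    required separately. *)
Definition ex_partials (f : C -> C) (z : C) : Prop :=
  ex_derive (fun t => Re (f (t, Im z))) (Re z) /\
  ex_derive (fun t => Im (f (t, Im z))) (Re z) /\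
  ex_derive (fun t => Re (f (Re z, t))) (Im z) /\
  ex_derive (fun t => Im (f (Re z, t))) (Im z).

Definition C1_on_disk (f : C -> C) : Prop :=
  forall z : C, disk z ->
    ex_partials f z /\ continuous (partial_x f) z /\ continuous (partial_y f) z.

Definition C2_on_disk (f : C -> C) : Prop :=
  C1_on_disk f /\ C1_on_disk (partial_x f) /\ C1_on_disk (partial_y f).

Definition laplacian (f : C -> C) (z : C) : C :=
  (partial_x (partial_x f) z + partial_y (partial_y f) z)%C.

Definition harmonic_on_disk (f : C -> C) : Prop :=
  C2_on_disk f /\ forall z : C, disk z -> laplacian f z = 0%C.

Definition wirtinger_z (f : C -> C) (z : C) : C :=
  ((partial_x f z - Ci * partial_y f z) / 2)%C.

Definition wirtinger_zbar (f : C -> C) (z : C) : C :=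
  ((partial_x f z + Ci * partial_y f z) / 2)%C.

(** ** Harmonic mappings *)

Definition analytic_on_disk (h : C -> C) : Prop :=
  forall z : C, disk z -> @ex_derive C_AbsRing C_NormedModule h z.

Definition canonical_representation (f h g : C -> C) : Prop :=
  analytic_on_disk h /\ analytic_on_disk g /\ f 0%C = h 0%C /\
  forall z : C, disk z -> f z = (h z + Cconj (g z))%C.

(** Positivity of the Jacobian of [f = h + conj g]. *)
Definition sense_preserving (h g : C -> C) : Prop :=
  forall z : C, disk z ->
    0 < Cmod (C_derive h z) ^ 2 - Cmod (C_derive g z) ^ 2.

(** ** Quasiconformality *)

Definition connected_set (A : C -> Prop) : Prop :=
  forall U V : C -> Prop, open U -> open V ->
    (forall z, A z -> U z \/ V z) ->
    (exists z, A z /\ U z) -> (exists z, A z /\ V z) ->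
    exists z, A z /\ U z /\ V z.

Definition domain (A : C -> Prop) : Prop :=
  (exists z, A z) /\ open A /\ connected_set A.

(** Since the disk and [A] are open, continuity of the total functions [f] and
    [finv] at the points of these sets is continuity of their restrictions. *)
Definition homeomorphism_of_disk_onto (f : C -> C) (A : C -> Prop) : Prop :=
  exists finv : C -> C,
    (forall z, disk z -> A (f z) /\ finv (f z) = z /\ continuous f z) /\
    (forall w, A w -> disk (finv w) /\ f (finv w) = w /\ continuous finv w).

(** The regularity condition W^{1,2}_loc appears in its classical form [C1]:
    a C^1 map belongs to W^{1,2}_loc, with its classical partial derivatives
    as weak ones, and harmonic mappings, the only ones considered here, are
    always C^1.  The quotient is meaningful when [|f_z| > |f_zbar|], which is
    what [sense_preserving] says for [f = h + conj g]. *)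
Definition quasiconformal_on_disk (K : R) (f : C -> C) : Prop :=
  (exists A : C -> Prop, domain A /\ homeomorphism_of_disk_onto f A) /\
  C1_on_disk f /\
  forall z : C, disk z ->
    (Cmod (wirtinger_z f z) + Cmod (wirtinger_zbar f z)) /
    (Cmod (wirtinger_z f z) - Cmod (wirtinger_zbar f z)) <= K.

(** ** The class of mappings under consideration *)

(** The value [b 0] plays no role: the expansion of [g] starts at [n = 1]. *)
Definition power_series_on_disk (h g : C -> C) (a b : nat -> C) : Prop :=
  forall z : C, disk z ->
    is_series (fun n : nat => (a n * z ^ n)%C) (h z) /\
    is_series (fun n : nat => (b (S n) * z ^ S n)%C) (g z).

Definition sense_preserving_qc_harmonic
    (K : R) (f h g : C -> C) (a b : nat -> C) : Prop :=
  harmonic_on_disk f /\ canonical_representation f h g /\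
  sense_preserving h g /\ quasiconformal_on_disk K f /\
  power_series_on_disk h g a b.

(** For [z] in the disk both real series converge, because the power series of
    [h] and [g] converge on the whole disk; [Series] is then their sum. *)
Definition bohr_sum (h : C -> C) (a b : nat -> C) (z : C) : R :=
  Cmod (h z)
  + Series (fun n : nat => Cmod (a (S n)) * Cmod z ^ S n)
  + Series (fun n : nat => Cmod (b (S n)) * Cmod z ^ S n).

Definition alpha (k : R) : R :=
  (sqrt (k ^ 2 + 12 * k + 12) - (2 * k + 3)) / (k + 1).

Definition B (a k : R) : R :=
  sqrt (a ^ 2 * (k ^ 2 + 8 * k + 8) + 2 * a * (k ^ 2 + 6 * k + 4) + (k + 2) ^ 2).

Definition bohr_radius (a k : R) : R :=
  (B a k - (k + 2) * (1 + a)) / (2 * a ^ 2 * (k + 1) + 2 * a * k).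

(* Main.v *)
Require Import Defs.
From Stdlib Require Import Classical ZArith Lra Lia Psatz.
Open Scope R_scope.

(** Write [a = |a_0|] and [r = |z|]; the condition [a >= alpha k] says exactly that
    the radius is at most [1/3].  If a quotient [G/H] is analytic and bounded by
    one in the disk, its Taylor coefficients satisfy [|c_0| + |c_n|/2 <= 1] for
    [n >= 1], whence [sum |c_n| r^n <= 1] for [r <= 1/3] (Bohr).  Applied to
    [g'/(k h')] this gives [sum |b_n| r^n <= k sum |a_n| r^n].  Applied, with an
    index shift, to [W = (a_0 - h)/(1 - conj a_0 h)], which vanishes at [0], it gives
    [sum |c_n(W)| r^n <= r]; solving [W (1 - conj a_0 h) = a_0 - h] for [h] yields
    [|h| <= (a + r)/(1 + a r)] and [sum |a_n| r^n <= (1 - a^2) r/(1 - a r)].  The sum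
    of these bounds is at most [1] iff [r] is at most the positive root of a quadratic,
    namely the stated radius.  All bounds are equalities for [h = (a - z)/(1 - a z)],
    [g = k (h - a)] and [z = -r].

    The coefficients of [F = G/H] are Fourier coefficients on circles: integration
    by parts shows that [J(t)], the integral of [F(t e^(is)) e^(-ims)] over
    [[0, 2 pi]], satisfies [t J' = m J], so [J(t)] is a multiple of [t^m]. *)

(** The quotient [G/H] is available as a differentiable function, not as a power series, and only
    two facts about its coefficients [c] are used: the coefficients of [G] are the convolution of
    those of [H] with [c], and [c] is small. Neither needs an expansion of the quotient: the
    convolution identity comes from circles shrinking to 0, the smallness from the positivity of an
    integral on circles growing to the unit circle.

    The positivity argument gives [|c_m| + |c_(m+n)|/2 <= 1] as soon as [c_(m-n) = 0]. For [m = 0]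
    this holds because negative coefficients vanish; for [m = 1] the only further case is [c_0 = 0],
    so [W] never has to be divided by [z]. This linear bound is weaker than [|c_n| <= 1 - |c_0|^2],
    but suffices because [2 (1/3 + 1/9 + ...) = 1]; the restriction [r <= 1/3] comes from there.

    Passing from [g'/h'] back to [g] and [h] costs nothing: the factors [(j+1)/(n+1)] with [j <= n]
    that appear are at most 1.

    Nine times the quadratic at [r = 1/3] is [(k+1) a^2 + (4k+6) a + 3k - 3], whose positive root is
    [alpha k]. *)

(** * Modulus inequalities and the topology of the complex plane *)

Lemma Cmod_minus_sym (z w : C) : Cmod (z - w) = Cmod (w - z).
Proof. rewrite <- Cmod_opp. f_equal. ring. Qed.

Lemma Cmod_le_parts (z : C) : Cmod z <= Rabs (Re z) + Rabs (Im z).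
Proof.
  pose proof (Rabs_pos (Re z)). pose proof (Rabs_pos (Im z)).
  apply Rsqr_incr_0_var; [|lra].
  rewrite !Rsqr_pow2, Cmod2_alt, <- (pow2_abs (Re z)), <- (pow2_abs (Im z)). nra.
Qed.

Lemma im_le_Cmod (z : C) : Rabs (Im z) <= Cmod z.
Proof.
  apply Rsqr_incr_0_var; [|apply Cmod_ge_0].
  rewrite !Rsqr_pow2, Cmod2_alt, pow2_abs. nra.
Qed.

Lemma C_ext (z w : C) : Re z = Re w -> Im z = Im w -> z = w.
Proof. destruct z, w; simpl; intros; subst; auto. Qed.

Lemma Cmod_triangle_rev (z w : C) : Cmod z - Cmod w <= Cmod (z - w).
Proof.
  replace z with ((z - w) + w)%C at 1 by ring.
  pose proof (Cmod_triangle (z - w) w). lra.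
Qed.

(** Coquelicot equips [C] with two uniform structures, the product one and the
    one of [Cmod]; they have the same neighbourhoods. *)
Lemma locally_C_iff (z : C) (P : C -> Prop) :
  @locally C_UniformSpace z P <->
  exists d, 0 < d /\ forall w, Cmod (w - z) < d -> P w.
Proof.
  split.
  - intros H. apply locally_C in H. destruct H as [d Hd].
    exists d; split; [apply cond_pos|]. exact Hd.
  - intros [d [Hd H]]. apply locally_C. exists (mkposreal d Hd). exact H.
Qed.

Lemma continuous_C_iff (F : C -> C) (z : C) :
  @continuous C_UniformSpace C_UniformSpace F z <->
  forall e, 0 < e -> exists d, 0 < d /\
    forall w, Cmod (w - z) < d -> Cmod (F w - F z) < e.
Proof.
  split.
  - intros H e He.
    apply (proj1 (locally_C_iff z (fun w => Cmod (F w - F z) < e))).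
    apply (H (fun w => Cmod (w - F z) < e)).
    apply locally_C_iff. exists e; auto.
  - intros H P HP. apply locally_C_iff in HP. destruct HP as [e [He HP]].
    destruct (H e He) as [d [Hd H']]. apply locally_C_iff.
    exists d; split; auto.
Qed.

(** * Complex differentiation in epsilon-delta form *)

Definition cderiv (F : C -> C) (z l : C) : Prop :=
  @is_derive C_AbsRing C_NormedModule F z l.

Lemma cderiv_iff (F : C -> C) (z l : C) :
  cderiv F z l <->
  forall e, 0 < e -> exists d, 0 < d /\ forall w, Cmod (w - z) < d ->
    Cmod (F w - F z - (w - z) * l) <= e * Cmod (w - z).
Proof.
  split.
  - intros [_ H] e He.
    destruct (H z (fun P HP => HP) (mkposreal e He)) as [d Hd].
    exists d; split; [apply cond_pos|]. intros w Hw. exact (Hd w Hw).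
  - intros H. split.
    + apply is_linear_scal_l.
    + intros x Hx.
      assert (z = x) as <- by
        (apply (@is_filter_lim_locally_unique C_AbsRing
            (AbsRing_NormedModule C_AbsRing)); exact Hx).
      intros e. destruct (H e (cond_pos e)) as [d [Hd H']].
      exists (mkposreal d Hd). intros w Hw. exact (H' w Hw).
Qed.

(** [C] is a normed module over itself in two ways: analyticity is stated with [C_NormedModule], the
    product rule with [AbsRing_NormedModule]. Both notions of derivative unfold to the same
    epsilon-delta condition, so rules can be transported. *)
Lemma cderiv_AbsRing (F : C -> C) (z l : C) :
  cderiv F z l <->
  @is_derive C_AbsRing (AbsRing_NormedModule C_AbsRing) F z l.
Proof.
  rewrite cderiv_iff. split.
  - intros H. split.
    + apply is_linear_scal_l.
    + intros x Hx.
      assert (z = x) as <- by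
        (apply (@is_filter_lim_locally_unique C_AbsRing
            (AbsRing_NormedModule C_AbsRing)); exact Hx).
      intros e. destruct (H e (cond_pos e)) as [d [Hd H']].
      exists (mkposreal d Hd). intros w Hw. exact (H' w Hw).
  - intros [_ H] e He.
    destruct (H z (fun P HP => HP) (mkposreal e He)) as [d Hd].
    exists d; split; [apply cond_pos|]. intros w Hw. exact (Hd w Hw).
Qed.

Lemma cderiv_continuous (F : C -> C) (z l : C) : cderiv F z l ->
  @continuous C_UniformSpace C_UniformSpace F z.
Proof.
  intros H. apply continuous_C_iff. intros e He.
  destruct (proj1 (cderiv_iff F z l) H 1 Rlt_0_1) as [d [Hd H1]].
  pose proof (Cmod_ge_0 l) as Hl.
  (* Within [d] the increment of [F] is at most [(1 + |l|) |w - z|]; the 2 makes the final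
     inequality strict. *)
  exists (Rmin d (e / (2 + Cmod l))). split.
  { apply Rmin_pos; auto. apply Rdiv_lt_0_compat; lra. }
  intros w Hw.
  assert (Hw1 : Cmod (w - z) < d) by (eapply Rlt_le_trans; [exact Hw|apply Rmin_l]).
  assert (Hw2 : Cmod (w - z) < e / (2 + Cmod l))
    by (eapply Rlt_le_trans; [exact Hw|apply Rmin_r]).
  apply (Rmult_lt_compat_r (2 + Cmod l)) in Hw2; [|lra].
  unfold Rdiv in Hw2. rewrite Rmult_assoc, Rinv_l, Rmult_1_r in Hw2 by lra.
  specialize (H1 w Hw1).
  replace (F w - F z)%C with ((F w - F z - (w - z) * l) + (w - z) * l)%C by ring.
  eapply Rle_lt_trans; [apply Cmod_triangle|]. rewrite Cmod_mult.
  pose proof (Cmod_ge_0 (w - z)). nra.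
Qed.

Lemma cderiv_ext_loc (F G : C -> C) (z l : C) :
  (exists d, 0 < d /\ forall w, Cmod (w - z) < d -> F w = G w) ->
  cderiv F z l -> cderiv G z l.
Proof.
  intros [d [Hd H]]. apply is_derive_ext_loc.
  exists (mkposreal d Hd). exact H.
Qed.

Lemma cderiv_const (c z : C) : cderiv (fun _ => c) z 0%C.
Proof. apply cderiv_AbsRing. apply @is_derive_const. Qed.

Lemma cderiv_id (z : C) : cderiv (fun w => w) z 1%C.
Proof. apply cderiv_AbsRing. apply @is_derive_id. Qed.

Lemma cderiv_plus (F G : C -> C) (z l m : C) :
  cderiv F z l -> cderiv G z m -> cderiv (fun w => F w + G w)%C z (l + m)%C.
Proof. intros H1 H2. exact (@is_derive_plus _ _ F G z l m H1 H2). Qed.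

Lemma cderiv_mult (F G : C -> C) (z l m : C) :
  cderiv F z l -> cderiv G z m ->
  cderiv (fun w => F w * G w)%C z (l * G z + F z * m)%C.
Proof.
  rewrite !cderiv_AbsRing. intros H1 H2.
  exact (@is_derive_mult _ F G z l m H1 H2 Cmult_comm).
Qed.

Lemma cderiv_scal (c : C) (F : C -> C) (z l : C) :
  cderiv F z l -> cderiv (fun w => c * F w)%C z (c * l)%C.
Proof.
  intros H. replace (c * l)%C with (0 * F z + c * l)%C by ring.
  apply (cderiv_mult (fun _ => c)); auto. apply cderiv_const.
Qed.

Lemma cderiv_inv (z : C) : z <> 0%C -> cderiv Cinv z (- / (z * z))%C.
Proof.
  intros Hz. assert (Hz' := proj1 (Cmod_gt_0 z) Hz).
  apply cderiv_iff. intros e He.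
  set (r := Cmod z) in *.
  (* The remainder is [(w - z)^2 / (z^2 w)]. The first bound gives [|w| > r/2], and then the second
     makes [|w - z| / (r^2 |w|)] at most [e]. *)
  exists (Rmin (r / 2) (e * r ^ 3 / 2)). split.
  { apply Rmin_pos; [lra|]. assert (0 < r ^ 3) by (apply pow_lt; auto). nra. }
  intros w Hw.
  assert (Hw1 : Cmod (w - z) < r / 2) by (eapply Rlt_le_trans; [exact Hw|apply Rmin_l]).
  assert (Hw2 : Cmod (w - z) < e * r ^ 3 / 2)
    by (eapply Rlt_le_trans; [exact Hw|apply Rmin_r]).
  assert (Hwr : r / 2 < Cmod w).
  { pose proof (Cmod_triangle_rev z w). rewrite Cmod_minus_sym in H. fold r in H. lra. }
  assert (Hw0 : w <> 0%C) by (apply Cmod_gt_0; lra).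
  replace (/ w - / z - (w - z) * - / (z * z))%C with ((w - z) * ((w - z) / (z * z * w)))%C
    by (field; auto).
  rewrite Cmod_mult, Rmult_comm.
  apply Rmult_le_compat_r; [apply Cmod_ge_0|].
  rewrite Cmod_div by (repeat apply Cmult_neq_0; auto).
  rewrite !Cmod_mult. fold r.
  assert (0 < r * r * Cmod w) by (repeat apply Rmult_lt_0_compat; lra).
  apply Rmult_le_reg_r with (r * r * Cmod w); auto.
  unfold Rdiv. rewrite Rmult_assoc, Rinv_l, Rmult_1_r by lra.
  assert (0 < e * (r * r)) by (apply Rmult_lt_0_compat; nra). nra.
Qed.

Lemma cderiv_inv_comp (F : C -> C) (z l : C) : F z <> 0%C ->
  cderiv F z l -> cderiv (fun w => / F w)%C z (- l / (F z * F z))%C.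
Proof.
  intros H0 H. apply cderiv_AbsRing in H.
  replace (- l / (F z * F z))%C with (l * (- / (F z * F z)))%C by (field; auto).
  exact (@is_derive_comp _ _ Cinv F z _ l (cderiv_inv (F z) H0) H).
Qed.

Lemma cderiv_div (F G : C -> C) (z l m : C) : G z <> 0%C ->
  cderiv F z l -> cderiv G z m ->
  cderiv (fun w => F w / G w)%C z ((l * G z - F z * m) / (G z * G z))%C.
Proof.
  intros H0 H1 H2.
  replace ((l * G z - F z * m) / (G z * G z))%C
    with (l * / G z + F z * (- m / (G z * G z)))%C by (field; auto).
  apply (cderiv_mult F (fun w => / G w)%C); auto.
  apply cderiv_inv_comp; auto.
Qed.

Lemma cderiv_unique (F : C -> C) (z l m : C) : cderiv F z l -> cderiv F z m -> l = m.
Proof.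
  intros H1 H2. apply is_C_derive_unique in H1, H2. congruence.
Qed.

(** ** Continuity of complex functions on any space *)

Section ContinuityC.
Context {T : UniformSpace}.
Implicit Types (F G : T -> C) (x : T).

Lemma continuous_C_parts F x :
  continuous (fun y => Re (F y)) x -> continuous (fun y => Im (F y)) x ->
  @continuous T C_UniformSpace F x.
Proof.
  intros H1 H2.
  intros P [e He].
  generalize (filter_and (F := locally x) _ _ (proj1 (filterlim_locally _ _) H1 e)
    (proj1 (filterlim_locally _ _) H2 e)).
  apply (filter_imp (F := locally x)). intros y [Hy1 Hy2]. apply He. split; auto.
Qed.

Lemma continuous_Re F x : @continuous T C_UniformSpace F x ->
  continuous (fun y => Re (F y)) x.
Proof.
  intros H. apply (continuous_comp (V := C_UniformSpace) F Re); auto.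
  apply (@continuous_fst R_UniformSpace R_UniformSpace).
Qed.

Lemma continuous_Im F x : @continuous T C_UniformSpace F x ->
  continuous (fun y => Im (F y)) x.
Proof.
  intros H. apply (continuous_comp (V := C_UniformSpace) F Im); auto.
  apply (@continuous_snd R_UniformSpace R_UniformSpace).
Qed.

Lemma continuous_Cplus F G x :
  @continuous T C_UniformSpace F x -> @continuous T C_UniformSpace G x ->
  @continuous T C_UniformSpace (fun y => F y + G y)%C x.
Proof.
  intros H1 H2. apply continuous_C_parts; simpl.
  - apply (continuous_plus (V := R_NormedModule)); apply continuous_Re; auto.
  - apply (continuous_plus (V := R_NormedModule)); apply continuous_Im; auto.
Qed.

Lemma continuous_Cmult F G x :
  @continuous T C_UniformSpace F x -> @continuous T C_UniformSpace G x ->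
  @continuous T C_UniformSpace (fun y => F y * G y)%C x.
Proof.
  intros H1 H2.
  pose proof (continuous_Re _ _ H1). pose proof (continuous_Im _ _ H1).
  pose proof (continuous_Re _ _ H2). pose proof (continuous_Im _ _ H2).
  apply continuous_C_parts; simpl.
  - apply (continuous_minus (V := R_NormedModule)); apply (continuous_mult (K := R_AbsRing)); auto.
  - apply (continuous_plus (V := R_NormedModule)); apply (continuous_mult (K := R_AbsRing)); auto.
Qed.

Lemma continuous_Cconj F x : @continuous T C_UniformSpace F x ->
  @continuous T C_UniformSpace (fun y => Cconj (F y)) x.
Proof.
  intros H. apply continuous_C_parts; simpl.
  - apply continuous_Re; auto.
  - apply (continuous_opp (V := R_NormedModule)). apply continuous_Im; auto.
Qed.

End ContinuityC.

(** ** Complex series *)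

Definition Cseries (c : nat -> C) (l : C) : Prop :=
  @is_series C_AbsRing C_NormedModule c l.

Lemma sum_n_Re (c : nat -> C) (n : nat) :
  Re (sum_n (G := C_AbelianMonoid) c n) = sum_n (fun k => Re (c k)) n.
Proof.
  induction n as [|n IH]; [rewrite !sum_O | rewrite !sum_Sn, <- IH]; auto.
Qed.

Lemma sum_n_Im (c : nat -> C) (n : nat) :
  Im (sum_n (G := C_AbelianMonoid) c n) = sum_n (fun k => Im (c k)) n.
Proof.
  induction n as [|n IH]; [rewrite !sum_O | rewrite !sum_Sn, <- IH]; auto.
Qed.

Lemma Cmod_sum_n (c : nat -> C) (n : nat) :
  Cmod (sum_n (G := C_AbelianMonoid) c n) <= sum_n (fun k => Cmod (c k)) n.
Proof.
  induction n as [|n IH]; [rewrite !sum_O | rewrite !sum_Sn]; [lra|].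
  eapply Rle_trans; [apply Cmod_triangle|]. apply Rplus_le_compat_r, IH.
Qed.

Lemma Cseries_iff (c : nat -> C) (l : C) :
  Cseries c l <->
  forall e, 0 < e -> exists N, forall n, (N <= n)%nat ->
    Cmod (sum_n (G := C_AbelianMonoid) c n - l) < e.
Proof.
  split.
  - intros H e He.
    refine (H (fun w => Cmod (w - l) < e) _).
    apply (proj2 (locally_C_iff l _)). exists e; auto.
  - intros H P HP. apply (proj1 (locally_C_iff l P)) in HP.
    destruct HP as [e [He HP]]. destruct (H e He) as [N HN].
    exists N. intros n Hn. apply HP, HN, Hn.
Qed.

Lemma Cseries_parts (c : nat -> C) (l : C) :
  Cseries c l <->
  is_series (fun n => Re (c n)) (Re l) /\ is_series (fun n => Im (c n)) (Im l).
Proof.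
  rewrite Cseries_iff. split.
  - intros H. split; [change (is_lim_seq (sum_n (fun n => Re (c n))) (Re l))
                     |change (is_lim_seq (sum_n (fun n => Im (c n))) (Im l))];
      apply is_lim_seq_spec; intros e;
      destruct (H e (cond_pos e)) as [N HN]; exists N; intros n Hn;
      specialize (HN n Hn).
    + rewrite <- sum_n_Re. eapply Rle_lt_trans; [|exact HN].
      eapply Rle_trans; [|apply re_le_Cmod]. apply Req_le. f_equal.
    + rewrite <- sum_n_Im. eapply Rle_lt_trans; [|exact HN].
      eapply Rle_trans; [|apply im_le_Cmod]. apply Req_le. f_equal.
  - intros [H1 H2] e He.
    change (is_lim_seq (sum_n (fun n => Re (c n))) (Re l)) in H1.
    change (is_lim_seq (sum_n (fun n => Im (c n))) (Im l)) in H2.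
    apply is_lim_seq_spec in H1, H2.
    assert (He2 : 0 < e / 2) by lra.
    destruct (H1 (mkposreal _ He2)) as [N1 HN1].
    destruct (H2 (mkposreal _ He2)) as [N2 HN2].
    exists (Nat.max N1 N2). intros n Hn.
    specialize (HN1 n ltac:(lia)). specialize (HN2 n ltac:(lia)).
    simpl in HN1, HN2. rewrite <- sum_n_Re in HN1. rewrite <- sum_n_Im in HN2.
    eapply Rle_lt_trans; [apply Cmod_le_parts|].
    unfold Rminus in HN1, HN2. rewrite <- re_opp, <- re_plus in HN1.
    rewrite <- im_opp, <- im_plus in HN2.
    unfold Cminus. lra.
Qed.

Lemma Cseries_unique (c : nat -> C) (l m : C) : Cseries c l -> Cseries c m -> l = m.
Proof.
  rewrite !Cseries_parts. intros [H1 H2] [H3 H4].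
  apply is_series_unique in H1, H2, H3, H4. apply C_ext; congruence.
Qed.

Lemma Cseries_ext (c d : nat -> C) (l : C) :
  (forall n, c n = d n) -> Cseries c l -> Cseries d l.
Proof. apply is_series_ext. Qed.

Lemma Cseries_plus (c d : nat -> C) (l m : C) :
  Cseries c l -> Cseries d m -> Cseries (fun n => c n + d n)%C (l + m)%C.
Proof. apply (@is_series_plus C_AbsRing C_NormedModule). Qed.

Lemma Cseries_scal (u : C) (c : nat -> C) (l : C) :
  Cseries c l -> Cseries (fun n => u * c n)%C (u * l)%C.
Proof. apply (@is_series_scal C_AbsRing C_NormedModule). Qed.

Lemma Cseries_incr (c : nat -> C) (l : C) :
  Cseries (fun n => c (S n)) l -> Cseries c (c O + l)%C.
Proof.
  intros H. apply (@is_series_decr_1 C_AbsRing C_NormedModule).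
  refine (eq_ind l (fun m => Cseries _ m) H _ _).
  change (l = (c O + l) + - c O)%C. ring.
Qed.

Lemma Cseries_decr (c : nat -> C) (l : C) :
  Cseries c l -> Cseries (fun n => c (S n)) (l - c O)%C.
Proof.
  intros H. apply (@is_series_incr_1 C_AbsRing C_NormedModule).
  refine (eq_ind l (fun m => Cseries _ m) H _ _).
  change (l = (l - c O) + c O)%C. ring.
Qed.

Lemma ex_Cseries_abs (c : nat -> C) (d : nat -> R) :
  (forall n, Cmod (c n) <= d n) -> ex_series d -> exists l, Cseries c l.
Proof. apply (@ex_series_le C_AbsRing C_CompleteNormedModule c d). Qed.

Lemma Cmod_series_le (c : nat -> C) (d : nat -> R) (l : C) (L : R) :
  Cseries c l -> is_series d L -> (forall n, Cmod (c n) <= d n) -> Cmod l <= L.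
Proof.
  intros Hc Hd Hle. apply Rnot_lt_le. intros Hlt.
  assert (He : 0 < (Cmod l - L) / 2) by lra.
  destruct (proj1 (Cseries_iff c l) Hc _ He) as [N1 H1].
  change (is_lim_seq (sum_n d) L) in Hd. apply is_lim_seq_spec in Hd. destruct (Hd (mkposreal _ He)) as [N2 H2].
  set (n := Nat.max N1 N2).
  specialize (H1 n ltac:(lia)). specialize (H2 n ltac:(lia)). simpl in H2.
  apply Rabs_def2 in H2.
  pose proof (Cmod_sum_n c n).
  assert (sum_n (fun k => Cmod (c k)) n <= sum_n d n) by (apply sum_n_m_le; auto).
  pose proof (Cmod_triangle_rev l (sum_n (G := C_AbelianMonoid) c n)).
  rewrite Cmod_minus_sym in H3. lra.
Qed.

Lemma sum_n_Rminus (u v : nat -> R) (n : nat) :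
  sum_n (fun k => u k - v k) n = sum_n u n - sum_n v n.
Proof.
  induction n as [|n IH]; [rewrite !sum_O; auto|].
  rewrite !sum_Sn, IH. unfold plus; simpl. ring.
Qed.

(** The Cauchy product splits into four real Cauchy products of real and imaginary parts, each
    absolutely convergent by domination. *)
Lemma Cseries_mult (a b : nat -> C) (l m : C) :
  Cseries a l -> Cseries b m ->
  ex_series (fun n => Cmod (a n)) -> ex_series (fun n => Cmod (b n)) ->
  Cseries (fun n => sum_n (G := C_AbelianMonoid) (fun k => a k * b (n - k)%nat)%C n) (l * m)%C.
Proof.
  rewrite !Cseries_parts. intros [Ha1 Ha2] [Hb1 Hb2] Ha Hb.
  assert (A : forall c : nat -> C, ex_series (fun n => Cmod (c n)) ->
     ex_series (fun n => Rabs (Re (c n))) /\ ex_series (fun n => Rabs (Im (c n)))).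
  { intros c Hc. split; (eapply (ex_series_le (V := R_CompleteNormedModule)); [|exact Hc]); intros n;
      (eapply Rle_trans; [apply Req_le, Rabs_Rabsolu|]).
    apply re_le_Cmod. apply im_le_Cmod. }
  destruct (A a Ha) as [Aa1 Aa2]. destruct (A b Hb) as [Ab1 Ab2].
  pose proof (is_series_mult _ _ _ _ Ha1 Hb1 Aa1 Ab1) as P1.
  pose proof (is_series_mult _ _ _ _ Ha2 Hb2 Aa2 Ab2) as P2.
  pose proof (is_series_mult _ _ _ _ Ha1 Hb2 Aa1 Ab2) as P3.
  pose proof (is_series_mult _ _ _ _ Ha2 Hb1 Aa2 Ab1) as P4.
  split.
  - rewrite re_mult. eapply is_series_ext; [|exact (is_series_minus _ _ _ _ P1 P2)].
    intros n. rewrite sum_n_Re, <- !sum_n_Reals.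
    etransitivity; [symmetry; apply sum_n_Rminus|].
    apply sum_n_ext. intros k. symmetry. apply re_mult.
  - rewrite im_mult. eapply is_series_ext; [|exact (is_series_plus _ _ _ _ P3 P4)].
    intros n. rewrite sum_n_Im, <- !sum_n_Reals. 
    rewrite <- sum_n_plus. apply sum_n_ext. intros k. symmetry. apply im_mult.
Qed.

(** ** Power series on the disk *)

Definition power_series (a : nat -> C) (F : C -> C) : Prop :=
  forall z, disk z -> Cseries (fun n => a n * z ^ n)%C (F z).

(** Taking moduli of the coefficients makes the theory of real power series applicable to complex
    ones. *)
Definition abs_radius (a : nat -> C) : Rbar := CV_radius (fun n => Cmod (a n)).

Lemma sum_n_nonneg_ge (u : nat -> R) (k n : nat) :
  (forall i, 0 <= u i) -> (k <= n)%nat -> u k <= sum_n u n.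
Proof.
  intros Hu. induction n as [|n IH]; intros Hk.
  - replace k with O by lia. rewrite sum_O. lra.
  - rewrite sum_Sn. unfold plus; simpl. destruct (Nat.eq_dec k (S n)) as [->|].
    + assert (0 <= sum_n u n).
      { eapply Rle_trans; [|apply (sum_n_m_le (fun _ => 0)); auto].
        rewrite sum_n_m_const. lra. }
      lra.
    + specialize (IH ltac:(lia)). specialize (Hu (S n)). lra.
Qed.

Lemma Cseries_terms_bounded (c : nat -> C) (l : C) :
  Cseries c l -> exists M, forall n, Cmod (c n) <= M.
Proof.
  intros H. destruct (proj1 (Cseries_iff c l) H 1 Rlt_0_1) as [N HN].
  exists (sum_n (fun k => Cmod (c k)) N + 2). intros n.
  assert (H0 : forall i, 0 <= Cmod (c i)) by (intros; apply Cmod_ge_0).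
  destruct (Nat.le_gt_cases n N) as [Hn|Hn].
  - pose proof (sum_n_nonneg_ge (fun k => Cmod (c k)) n N H0 Hn). simpl in *. lra.
  - pose proof (sum_n_nonneg_ge (fun k => Cmod (c k)) O N H0 ltac:(lia)). simpl in *.
    destruct n as [|n]; [lia|].
    pose proof (HN n ltac:(lia)) as E1. pose proof (HN (S n) ltac:(lia)) as E2.
    rewrite sum_Sn in E2.
    set (s := sum_n (G := C_AbelianMonoid) c n) in *.
    change (plus s (c (S n))) with (s + c (S n))%C in E2.
    (* Beyond [N] a term is the difference of two partial sums within 1 of the limit, hence of
       modulus below 2. *)
    replace (c (S n)) with ((s + c (S n) - l) - (s - l))%C by ring.
    unfold Cminus at 1. pose proof (Cmod_triangle (s + c (S n) - l) (- (s - l))).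
    rewrite Cmod_opp in H2. specialize (H0 O). lra.
Qed.

Lemma disk_R (r : R) : 0 <= r < 1 -> disk r.
Proof. intros H. unfold disk. rewrite Cmod_R, Rabs_pos_eq; lra. Qed.

Lemma power_series_radius (a : nat -> C) (F : C -> C) :
  power_series a F -> Rbar_le 1 (abs_radius a).
Proof.
  intros H.
  assert (A : forall r : R, 0 <= r < 1 -> Rbar_le r (abs_radius a)).
  { intros r Hr. apply (proj1 (CV_radius_bounded (fun n => Cmod (a n)))).
    destruct (Cseries_terms_bounded _ _ (H r (disk_R r Hr))) as [M HM].
    exists M. intros n. eapply Rle_trans; [|apply (HM n)].
    rewrite Rabs_mult, Rabs_pos_eq by apply Cmod_ge_0.
    rewrite Cmod_mult, Cmod_pow, Cmod_R, RPow_abs. apply Rle_refl. }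
  pose proof (CV_radius_ge_0 (fun n => Cmod (a n))) as H0. unfold abs_radius in *.
  destruct (CV_radius _) as [x| |]; simpl in *; auto.
  apply Rnot_lt_le. intros Hx. specialize (A ((x + 1) / 2) ltac:(lra)). lra.
Qed.

Lemma abs_radius_bounded (a : nat -> C) (M : R) :
  (forall n, Cmod (a n) <= M) -> Rbar_le 1 (abs_radius a).
Proof.
  intros H. apply (proj1 (CV_radius_bounded (fun n => Cmod (a n)))).
  exists M. intros n. rewrite pow1, Rmult_1_r, Rabs_pos_eq by apply Cmod_ge_0. auto.
Qed.

Lemma abs_radius_ex_series (a : nat -> C) (r : R) :
  Rbar_le 1 (abs_radius a) -> 0 <= r < 1 -> ex_series (fun n => Cmod (a n) * r ^ n).
Proof.
  intros Ha Hr.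
  eapply ex_series_ext; [|apply (CV_disk_inside (fun n => Cmod (a n)) r)].
  - intros n. simpl. apply Rabs_pos_eq. apply Rmult_le_pos; [apply Cmod_ge_0|].
    apply pow_le; lra.
  - eapply Rbar_lt_le_trans; [|exact Ha]. simpl. rewrite Rabs_pos_eq; lra.
Qed.

Lemma abs_radius_is_series (a : nat -> C) (r : R) :
  Rbar_le 1 (abs_radius a) -> 0 <= r < 1 ->
  is_series (fun n => Cmod (a n) * r ^ n) (PSeries (fun n => Cmod (a n)) r).
Proof. intros Ha Hr. apply Series_correct, abs_radius_ex_series; auto. Qed.

Definition Csum (c : nat -> C) : C :=
  (Series (fun n => Re (c n)), Series (fun n => Im (c n))).

Lemma Csum_correct (c : nat -> C) : (exists l, Cseries c l) -> Cseries c (Csum c).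
Proof.
  intros [l Hl]. apply Cseries_parts in Hl. destruct Hl.
  apply Cseries_parts; split; apply Series_correct; eexists; eauto.
Qed.

Lemma abs_radius_power_series (a : nat -> C) :
  Rbar_le 1 (abs_radius a) ->
  power_series a (fun z => Csum (fun n => a n * z ^ n)%C).
Proof.
  intros Ha z Hz. apply Csum_correct.
  apply (ex_Cseries_abs _ (fun n => Cmod (a n) * Cmod z ^ n)).
  - intros n. rewrite Cmod_mult, Cmod_pow. lra.
  - apply abs_radius_ex_series; auto. split; [apply Cmod_ge_0|exact Hz].
Qed.

Definition deriv_coef (a : nat -> C) (n : nat) : C := (RtoC (INR (S n)) * a (S n))%C.

Lemma abs_radius_deriv_coef (a : nat -> C) :
  abs_radius (deriv_coef a) = abs_radius a.
Proof.
  unfold abs_radius. rewrite <- (CV_radius_derive (fun n => Cmod (a n))).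
  apply CV_radius_ext. intros n. unfold deriv_coef, PS_derive.
  rewrite Cmod_mult, Cmod_R, Rabs_pos_eq by apply pos_INR. auto.
Qed.

Definition pow_rem (n : nat) (z w : C) : C :=
  ((z + w) ^ n - z ^ n - RtoC (INR n) * z ^ pred n * w)%C.

Lemma pow_rem_S (n : nat) (z w : C) :
  pow_rem (S n) z w
  = ((z + w) * pow_rem n z w + RtoC (INR n) * z ^ pred n * w * w)%C.
Proof.
  unfold pow_rem. rewrite S_INR, RtoC_plus. simpl pred.
  destruct n as [|n].
  - simpl. ring.
  - simpl pred. rewrite !Cpow_S. ring.
Qed.

(** As a polynomial in [z] and [w], [pow_rem n z w] has nonnegative coefficients, so its modulus is
    at most its value at the moduli; the induction follows the recursion [pow_rem_S]. *)
Lemma Cmod_pow_rem (n : nat) (z w : C) :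
  Cmod (pow_rem n z w) <=
  (Cmod z + Cmod w) ^ n - Cmod z ^ n - INR n * Cmod z ^ pred n * Cmod w.
Proof.
  induction n as [|n IH].
  - unfold pow_rem. simpl. replace (1 - 1 - 0 * 1 * w)%C with (RtoC 0) by ring.
    rewrite Cmod_0. lra.
  - rewrite pow_rem_S. eapply Rle_trans; [apply Cmod_triangle|].
    rewrite !Cmod_mult, Cmod_pow, Cmod_R, Rabs_pos_eq by apply pos_INR.
    pose proof (Cmod_ge_0 z). pose proof (Cmod_ge_0 w).
    pose proof (Cmod_ge_0 (pow_rem n z w)).
    eapply Rle_trans.
    { apply Rplus_le_compat_r. apply Rmult_le_compat; [apply Cmod_ge_0|auto| |exact IH].
      apply Cmod_triangle. }
    rewrite S_INR. destruct n as [|n]; simpl pred; simpl pow; simpl INR; apply Req_le; ring.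
Qed.

(** The remainder of order one of [F] at [z] is dominated by that of the real
    series [sum |a_n| x^n] at [|z|], whose differentiability is known. *)
Lemma power_series_deriv (a : nat -> C) (F : C -> C) : power_series a F ->
  exists F', power_series (deriv_coef a) F' /\ forall z, disk z -> cderiv F z (F' z).
Proof.
  intros H. pose proof (power_series_radius a F H) as Ha.
  assert (Ha' : Rbar_le 1 (abs_radius (deriv_coef a)))
    by (rewrite abs_radius_deriv_coef; auto).
  pose proof (abs_radius_power_series _ Ha') as H'.
  set (F' := fun z => Csum (fun n => deriv_coef a n * z ^ n)%C) in H'.
  exists F'; split; auto. intros z Hz. apply cderiv_iff. intros e He.
  set (b := fun n => Cmod (a n)). set (r := Cmod z).
  assert (Hr : 0 <= r < 1) by (split; [apply Cmod_ge_0|exact Hz]).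
  assert (Hrad : Rbar_lt (Rabs r) (CV_radius b)).
  { eapply Rbar_lt_le_trans; [|exact Ha]. simpl. rewrite Rabs_pos_eq; lra. }
  pose proof (is_derive_PSeries b r Hrad) as [_ HD].
  destruct (HD r (fun P HP => HP) (mkposreal e He)) as [d Hd].
  (* [d] serves the real series at [r]; [1 - r] keeps both [w] and the real point [r + |w - z|]
     inside the region of convergence. *)
  exists (Rmin d (1 - r)). split.
  { apply Rmin_pos; [apply cond_pos|lra]. }
  intros w Hw.
  assert (Hw1 : Cmod (w - z) < d) by (eapply Rlt_le_trans; [exact Hw|apply Rmin_l]).
  assert (Hw2 : Cmod (w - z) < 1 - r) by (eapply Rlt_le_trans; [exact Hw|apply Rmin_r]).
  set (u := (w - z)%C) in *. set (s := Cmod u) in *.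
  assert (Hs : 0 <= s) by apply Cmod_ge_0.
  assert (Hwd : disk w).
  { unfold disk. replace w with (z + u)%C by (unfold u; ring).
    eapply Rle_lt_trans; [apply Cmod_triangle|]. fold r s. lra. }
  assert (S1 : Cseries (fun n => a n * pow_rem n z u)%C (F w - F z - u * F' z)%C).
  { pose proof (H w Hwd) as A1. pose proof (H z Hz) as A2.
    pose proof (Cseries_scal u _ _ (H' z Hz)) as A3.
    assert (A4 : Cseries (fun n => a n * (RtoC (INR n) * z ^ pred n * u))%C (u * F' z)%C).
    { replace (u * F' z)%C with (a O * (RtoC (INR 0) * z ^ pred 0 * u) + u * F' z)%C
        by (simpl; ring).
      apply (Cseries_incr (fun n => a n * (RtoC (INR n) * z ^ pred n * u))%C).
      eapply Cseries_ext; [|exact A3]. intros n. unfold deriv_coef. simpl pred. ring. }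
    pose proof (Cseries_plus _ _ _ _ (Cseries_plus _ _ _ _ A1 (Cseries_scal (-1) _ _ A2))
       (Cseries_scal (-1) _ _ A4)) as A5.
    replace (F w - F z - u * F' z)%C with (F w + -1 * F z + -1 * (u * F' z))%C by ring.
    eapply Cseries_ext; [|exact A5]. intros n. simpl. unfold pow_rem.
    replace (z + u)%C with w by (unfold u; ring). ring. }
  set (f := PSeries b) in *. set (f' := PSeries (PS_derive b) r) in *.
  assert (S2 : is_series (fun n => b n * ((r + s) ^ n - r ^ n - INR n * r ^ pred n * s))
                 (f (r + s) - f r - s * f')).
  { pose proof (abs_radius_is_series a (r + s) Ha ltac:(lra)) as A1.
    pose proof (abs_radius_is_series a r Ha Hr) as A2.
    assert (A3 : is_series (fun n => PS_derive b n * r ^ n) f').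
    { apply Series_correct.
      eapply ex_series_ext; [|apply (abs_radius_ex_series _ r Ha' Hr)].
      intros n. unfold PS_derive, deriv_coef.
      rewrite Cmod_mult, Cmod_R, Rabs_pos_eq by apply pos_INR. auto. }
    apply (is_series_scal s) in A3.
    assert (A4 : is_series (fun n => b n * (INR n * r ^ pred n * s)) (s * f')).
    { apply is_series_decr_1.
      refine (eq_ind (scal s f') (fun m => is_series _ m) _ _ _);
        [|unfold scal, mult, plus, opp; simpl; unfold mult; simpl; ring].
      eapply is_series_ext; [|exact A3]. intros n. unfold PS_derive, scal; simpl.
      unfold mult; simpl. ring. }
    pose proof (is_series_minus _ _ _ _ (is_series_minus _ _ _ _ A1 A2) A4) as A5.
    eapply is_series_ext; [|exact A5]. intros n. unfold plus, opp, b; simpl. ring. }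
  eapply Rle_trans.
  { apply (Cmod_series_le _ _ _ _ S1 S2). intros n. rewrite Cmod_mult.
    apply Rmult_le_compat_l; [apply Cmod_ge_0|apply Cmod_pow_rem]. }
  assert (Hball : ball r d (r + s)).
  { unfold ball; simpl. unfold AbsRing_ball, minus, plus, opp, abs; simpl.
    replace (r + s + - r) with s by ring. rewrite Rabs_pos_eq; lra. }
  specialize (Hd (r + s) Hball).
  unfold norm, minus, plus, opp, scal in Hd; simpl in Hd.
  unfold mult, abs in Hd; simpl in Hd.
  replace (r + s + - r) with s in Hd by ring. rewrite (Rabs_pos_eq s) in Hd by auto.
  eapply Rle_trans; [|exact Hd]. eapply Rle_trans; [|apply Rle_abs].
  apply Req_le. unfold f, f'. ring.
Qed.

(** Factoring [z^(n+1)] out of the tail leaves a series dominated by its value at [|z| = 1/2]; the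
    constant is [2^(n+1)] times the tail of [sum |a_k| 2^(-k)]. *)
Lemma power_series_tail (a : nat -> C) (F : C -> C) (n : nat) : power_series a F ->
  exists K, forall z, Cmod z <= / 2 ->
    Cmod (F z - sum_n (G := C_AbelianMonoid) (fun k => a k * z ^ k)%C n) <= K * Cmod z ^ S n.
Proof.
  intros H. pose proof (power_series_radius a F H) as Ha.
  pose proof (abs_radius_ex_series a (/ 2) Ha ltac:(lra)) as E.
  apply (ex_series_incr_n _ (S n)) in E. 
  destruct E as [L HL].
  exists (L * 2 ^ S n). intros z Hz.
  assert (Hzd : disk z) by (unfold disk; lra).
  assert (S1 : Cseries (fun k => a (S n + k)%nat * z ^ (S n + k))%C
    (F z - sum_n (G := C_AbelianMonoid) (fun k => a k * z ^ k)%C n)%C).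
  { apply (is_series_incr_n (V := C_NormedModule) (fun k => a k * z ^ k)%C (S n)); [lia|].
    refine (eq_ind (F z) (fun m => Cseries _ m) (H z Hzd) _ _). simpl pred.
    set (t := sum_n _ n). change (F z = (F z - t) + t)%C. ring. }
  pose proof (is_series_scal (2 ^ S n * Cmod z ^ S n) _ _ HL) as S2.
  replace (L * 2 ^ S n * Cmod z ^ S n) with (scal (2 ^ S n * Cmod z ^ S n) L)
    by (unfold scal; simpl; unfold mult; simpl; ring).
  apply (Cmod_series_le _ _ _ _ S1 S2). intros k.
  rewrite Cmod_mult, Cmod_pow, pow_add.
  change (scal ?x ?y) with (x * y). cbv beta.
  pose proof (Cmod_ge_0 z). pose proof (Cmod_ge_0 (a (S n + k)%nat)).
  rewrite (pow_add (/ 2)). rewrite pow_inv.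
  assert (0 < 2 ^ S n) by (apply pow_lt; lra).
  replace (2 ^ S n * Cmod z ^ S n * (Cmod (a (S n + k)%nat) * (/ 2 ^ S n * (/ 2) ^ k)))
    with (Cmod (a (S n + k)%nat) * (Cmod z ^ S n * (/ 2) ^ k)) by (field; lra).
  apply Rmult_le_compat_l; auto. apply Rmult_le_compat_l; [apply pow_le; auto|].
  apply pow_incr; auto.
Qed.

(** ** Integrals over circles *)

Definition cis (x : R) : C := (cos x, sin x).

(** The parameter is real, so the derivative is taken componentwise; real derivatives and [RInt]
    then apply to each component. *)
Definition curve_deriv (g : R -> C) (s : R) (l : C) : Prop :=
  is_derive (fun u => Re (g u)) s (Re l) /\ is_derive (fun u => Im (g u)) s (Im l).

Lemma Cmod_cis (x : R) : Cmod (cis x) = 1.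
Proof.
  unfold Cmod, cis; simpl.
  replace (cos x * (cos x * 1) + sin x * (sin x * 1)) with 1.
  apply sqrt_1. pose proof (sin2_cos2 x). unfold Rsqr in H. lra.
Qed.

Lemma cis_plus (x y : R) : cis (x + y) = (cis x * cis y)%C.
Proof.
  unfold cis. rewrite cos_plus, sin_plus. apply C_ext; simpl; ring.
Qed.

Lemma cis_0 : cis 0 = 1%C.
Proof. unfold cis. rewrite cos_0, sin_0. auto. Qed.

Lemma cis_pow (x : R) (n : nat) : (cis x ^ n)%C = cis (INR n * x).
Proof.
  induction n as [|n IH].
  - simpl. rewrite Rmult_0_l, cis_0. auto.
  - rewrite Cpow_S, IH, <- cis_plus, S_INR. f_equal. ring.
Qed.

Lemma cis_nat_period (n : nat) : cis (INR n * (2 * PI)) = 1%C.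
Proof.
  unfold cis. replace (INR n * (2 * PI)) with (0 + 2 * INR n * PI) by ring.
  rewrite cos_period, sin_period, cos_0, sin_0. auto.
Qed.

Lemma cis_Z_period (m : Z) : cis (IZR m * (2 * PI)) = 1%C.
Proof.
  destruct (Z.le_gt_cases 0 m) as [Hm|Hm].
  - replace m with (Z.of_nat (Z.to_nat m)) by lia.
    rewrite <- INR_IZR_INZ. apply cis_nat_period.
  - transitivity (cis (INR (Z.to_nat (- m)) * (2 * PI)) * cis (IZR m * (2 * PI)))%C.
    + rewrite cis_nat_period. ring.
    + rewrite <- cis_plus, INR_IZR_INZ, Z2Nat.id, opp_IZR by lia.
      replace (- IZR m * (2 * PI) + IZR m * (2 * PI)) with 0 by ring. apply cis_0.
Qed.

Lemma curve_deriv_const (c : C) (s : R) : curve_deriv (fun _ => c) s 0%C.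
Proof. split; apply (is_derive_const (V := R_NormedModule)). Qed.

Lemma curve_deriv_mult (f g : R -> C) (s : R) (l m : C) :
  curve_deriv f s l -> curve_deriv g s m ->
  curve_deriv (fun u => f u * g u)%C s (l * g s + f s * m)%C.
Proof.
  intros [H1 H2] [H3 H4].
  pose proof (is_derive_mult _ _ _ _ _ H1 H3 Rmult_comm) as P1.
  pose proof (is_derive_mult _ _ _ _ _ H2 H4 Rmult_comm) as P2.
  pose proof (is_derive_mult _ _ _ _ _ H1 H4 Rmult_comm) as P3.
  pose proof (is_derive_mult _ _ _ _ _ H2 H3 Rmult_comm) as P4.
  split.
  - pose proof (is_derive_minus _ _ _ _ _ P1 P2) as P.
    eapply is_derive_ext; [|eapply (eq_rect _ (is_derive _ s) P)].
    + intros t. symmetry. apply re_mult.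
    + destruct l, m; unfold minus, plus, opp, mult; simpl; unfold mult, Re, Im; simpl; ring.
  - pose proof (is_derive_plus _ _ _ _ _ P3 P4) as P.
    eapply is_derive_ext; [|eapply (eq_rect _ (is_derive _ s) P)].
    + intros t. symmetry. apply im_mult.
    + destruct l, m; unfold minus, plus, opp, mult; simpl; unfold mult, Re, Im; simpl; ring.
Qed.

Lemma curve_deriv_cis (k s : R) :
  curve_deriv (fun u => cis (k * u)) s (Ci * RtoC k * cis (k * s))%C.
Proof.
  unfold curve_deriv, cis; simpl. split; auto_derive; auto; ring.
Qed.

Lemma curve_deriv_RtoC (s : R) : curve_deriv RtoC s 1%C.
Proof.
  unfold curve_deriv; simpl. split; auto_derive; auto; ring.
Qed.

(** Multiplication by [l = p + iq] is the real matrix with rows [(p, -q)] and [(q, p)]: these are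
    the Cauchy-Riemann equations. *)
Lemma cderiv_differentiable (F : C -> C) (z l : C) : cderiv F z l ->
  differentiable_pt_lim (fun x y => Re (F (x, y))) (Re z) (Im z) (Re l) (- Im l) /\
  differentiable_pt_lim (fun x y => Im (F (x, y))) (Re z) (Im z) (Im l) (Re l).
Proof.
  intros H.
  assert (A : forall e : posreal, exists d : posreal, forall u v,
     Rabs (u - Re z) < d -> Rabs (v - Im z) < d ->
     Cmod (F (u, v) - F z - ((u, v) - z) * l)
       <= e * Rmax (Rabs (u - Re z)) (Rabs (v - Im z))).
  (* The modulus of the increment is at most twice the larger coordinate increment, hence
     [e / 2]. *)
  { intros e. assert (He : 0 < e / 2) by (pose proof (cond_pos e); lra).
    destruct (proj1 (cderiv_iff F z l) H _ He) as [d [Hd H']].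
    assert (Hd2 : 0 < d / 2) by lra.
    exists (mkposreal _ Hd2). simpl. intros u v Hu Hv.
    assert (B : Cmod ((u, v) - z) <= Rabs (u - Re z) + Rabs (v - Im z))
      by apply (Cmod_le_parts ((u, v) - z)).
    eapply Rle_trans; [apply (H' (u, v)); lra|].
    pose proof (Rmax_l (Rabs (u - Re z)) (Rabs (v - Im z))).
    pose proof (Rmax_r (Rabs (u - Re z)) (Rabs (v - Im z))).
    replace (e * Rmax (Rabs (u - Re z)) (Rabs (v - Im z))) with
      (e / 2 * (2 * Rmax (Rabs (u - Re z)) (Rabs (v - Im z)))) by field.
    apply Rmult_le_compat_l; lra. }
  assert (Ez : (Re z, Im z) = z) by (destruct z; auto).
  split; intros e; destruct (A e) as [d Hd]; exists d; intros u v Hu Hv;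
    (eapply Rle_trans; [|apply (Hd u v Hu Hv)]).
  - eapply Rle_trans; [|apply re_le_Cmod]. apply Req_le. f_equal. simpl.
    destruct z, l; simpl. unfold Re; simpl. ring.
  - eapply Rle_trans; [|apply im_le_Cmod]. apply Req_le. f_equal. simpl.
    destruct z, l; simpl. unfold Im; simpl. ring.
Qed.

(** The inner map has a real variable and the outer one a complex variable, so the two-variable real
    chain rule is applied to each component of [F]. *)
Lemma curve_deriv_comp (F : C -> C) (g : R -> C) (s : R) (l m : C) :
  cderiv F (g s) l -> curve_deriv g s m -> curve_deriv (fun u => F (g u)) s (l * m)%C.
Proof.
  intros H [H1 H2]. apply is_derive_Reals in H1, H2.
  destruct (cderiv_differentiable F _ _ H) as [D1 D2].
  assert (Eg : forall u, (Re (g u), Im (g u)) = g u) by (intros u; destruct (g u); auto).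
  split.
  - pose proof (derivable_pt_lim_comp_2d _ (fun u => Re (g u)) (fun u => Im (g u))
      s _ _ _ _ D1 H1 H2) as P. apply is_derive_Reals in P.
    eapply is_derive_ext; [|eapply (eq_rect _ (is_derive _ s) P)].
    + intros t; simpl. rewrite Eg. auto.
    + destruct l, m; simpl. ring.
  - pose proof (derivable_pt_lim_comp_2d _ (fun u => Re (g u)) (fun u => Im (g u))
      s _ _ _ _ D2 H1 H2) as P. apply is_derive_Reals in P.
    eapply is_derive_ext; [|eapply (eq_rect _ (is_derive _ s) P)].
    + intros t; simpl. rewrite Eg. auto.
    + destruct l, m; simpl. ring.
Qed.

Definition ccont (g : R -> C) : Prop :=
  forall s : R, @continuous R_UniformSpace C_UniformSpace g s.

Lemma ccont_mult (f g : R -> C) : ccont f -> ccont g -> ccont (fun u => f u * g u)%C.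
Proof. intros H1 H2 s. apply continuous_Cmult; auto. Qed.

Lemma ccont_plus (f g : R -> C) : ccont f -> ccont g -> ccont (fun u => f u + g u)%C.
Proof. intros H1 H2 s. apply continuous_Cplus; auto. Qed.

Lemma ccont_const (c : C) : ccont (fun _ => c).
Proof. intros s. apply continuous_const. Qed.

Lemma ccont_scal (c : C) (g : R -> C) : ccont g -> ccont (fun u => c * g u)%C.
Proof. apply ccont_mult, ccont_const. Qed.

Lemma ccont_cis (k : R) : ccont (fun u => cis (k * u)).
Proof.
  intros s. destruct (curve_deriv_cis k s) as [H1 H2].
  apply continuous_C_parts; apply (ex_derive_continuous (V := R_NormedModule));
    eexists; eauto.
Qed.

Definition cint (g : R -> C) : C :=
  (RInt (fun u => Re (g u)) 0 (2 * PI), RInt (fun u => Im (g u)) 0 (2 * PI)).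

Lemma ex_RInt_parts (g : R -> C) (a b : R) : ccont g ->
  ex_RInt (fun u => Re (g u)) a b /\ ex_RInt (fun u => Im (g u)) a b.
Proof.
  intros H. split; apply (ex_RInt_continuous (V := R_CompleteNormedModule));
    intros s _; [apply continuous_Re|apply continuous_Im]; apply H.
Qed.

Lemma cint_ext (f g : R -> C) : (forall u, f u = g u) -> cint f = cint g.
Proof.
  intros H. unfold cint. f_equal; apply RInt_ext; intros u _; rewrite H; auto.
Qed.

Lemma cint_plus (f g : R -> C) : ccont f -> ccont g ->
  cint (fun u => f u + g u)%C = (cint f + cint g)%C.
Proof.
  intros Hf Hg. destruct (ex_RInt_parts f 0 (2 * PI) Hf). destruct (ex_RInt_parts g 0 (2 * PI) Hg).
  apply C_ext; simpl.
  - apply (RInt_plus (V := R_CompleteNormedModule)); auto.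
  - apply (RInt_plus (V := R_CompleteNormedModule)); auto.
Qed.

Lemma cint_scal (c : C) (f : R -> C) : ccont f ->
  cint (fun u => c * f u)%C = (c * cint f)%C.
Proof.
  intros Hf. destruct (ex_RInt_parts f 0 (2 * PI) Hf) as [E1 E2].
  assert (S : forall (k : R) (h : R -> R), ex_RInt h 0 (2 * PI) ->
    RInt (fun u => k * h u) 0 (2 * PI) = k * RInt h 0 (2 * PI)).
  { intros k h Hh. apply (RInt_scal (V := R_CompleteNormedModule)); auto. }
  assert (E : forall (k : R) (h : R -> R), ex_RInt h 0 (2 * PI) ->
    ex_RInt (fun u => k * h u) 0 (2 * PI)).
  { intros k h Hh. apply (ex_RInt_scal (V := R_CompleteNormedModule)); auto. }
  destruct c as [x y]. apply C_ext; simpl; rewrite <- !S by auto.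
  - apply (RInt_minus (V := R_CompleteNormedModule) (fun u => x * Re (f u))
      (fun u => y * Im (f u))); auto.
  - apply (RInt_plus (V := R_CompleteNormedModule) (fun u => x * Im (f u))
      (fun u => y * Re (f u))); auto.
Qed.

Lemma cint_const (c : C) : cint (fun _ => c) = (RtoC (2 * PI) * c)%C.
Proof.
  unfold cint. rewrite !RInt_const. destruct c; unfold scal; simpl; unfold mult; simpl.
  apply C_ext; simpl; ring.
Qed.

(** Real and imaginary parts are estimated separately, whence [4 * PI] instead of [2 * PI]. The
    bound serves only in limits [t -> 0], where the constant is harmless. *)
Lemma Cmod_cint_le (f : R -> C) (M : R) : ccont f -> (forall u, Cmod (f u) <= M) ->
  Cmod (cint f) <= 4 * PI * M.
Proof.
  intros Hf HM. destruct (ex_RInt_parts f 0 (2 * PI) Hf).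
  pose proof PI_RGT_0.
  assert (B : forall h : R -> R, ex_RInt h 0 (2 * PI) -> (forall u, Rabs (h u) <= M) ->
    Rabs (RInt h 0 (2 * PI)) <= 2 * PI * M).
  { intros h Hh Hb.
    pose proof (abs_RInt_le_const h 0 (2 * PI) M ltac:(lra) Hh (fun t _ => Hb t)). lra. }
  eapply Rle_trans; [apply Cmod_le_parts|]. simpl.
  pose proof (B _ H (fun u => Rle_trans _ _ _ (re_le_Cmod _) (HM u))).
  pose proof (B _ H0 (fun u => Rle_trans _ _ _ (im_le_Cmod _) (HM u))). lra.
Qed.

Lemma cint_deriv (g g' : R -> C) : (forall s, curve_deriv g s (g' s)) -> ccont g' ->
  cint g' = (g (2 * PI)%R - g 0%R)%C.
Proof.
  intros H Hc. apply C_ext; simpl.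
  - apply (is_RInt_unique (V := R_CompleteNormedModule)).
    apply (is_RInt_derive (V := R_CompleteNormedModule) (fun u => Re (g u))).
    + intros s _. apply H.
    + intros s _. apply continuous_Re. apply Hc.
  - apply (is_RInt_unique (V := R_CompleteNormedModule)).
    apply (is_RInt_derive (V := R_CompleteNormedModule) (fun u => Im (g u))).
    + intros s _. apply H.
    + intros s _. apply continuous_Im. apply Hc.
Qed.

(** Differentiation under the integral for an integrand that is regular only for parameters in an
    open interval. On that strip the explicit [f'] coincides with the total [Derive]. *)
Lemma is_derive_RInt_strip (f f' : R -> R -> R) (a b lo hi x : R) :
  (forall u y, lo < u < hi -> is_derive (fun v => f v y) u (f' u y)) ->
  (forall u y, lo < u < hi ->
     continuous (fun p : R * R => f' (fst p) (snd p)) (u, y)) ->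
  (forall u y, lo < u < hi -> continuous (f u) y) ->
  lo < x < hi -> is_derive (fun u => RInt (f u) a b) x (RInt (f' x) a b).
Proof.
  intros Hd Hc Hf Hx.
  assert (L : locally x (fun u => lo < u < hi)).
  { apply filter_and.
    - apply (open_gt lo x). lra.
    - apply (open_lt hi x). lra. }
  replace (RInt (f' x) a b) with (RInt (fun t => Derive (fun u => f u t) x) a b).
  2:{ apply RInt_ext. intros t _. apply is_derive_unique, Hd, Hx. }
  apply is_derive_RInt_param.
  - revert L. apply filter_imp. intros u Hu t _. eexists. apply Hd, Hu.
  - intros t _. apply (continuity_2d_pt_ext_loc f').
    + destruct L as [d Hd']. exists d. intros u v Hu Hv. symmetry.
      apply is_derive_unique, Hd. apply Hd'. exact Hu.
    + apply continuity_2d_pt_filterlim. apply (Hc x t Hx).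
  - revert L. apply filter_imp. intros u Hu.
    apply (ex_RInt_continuous (V := R_CompleteNormedModule)). intros y _. apply Hf, Hu.
Qed.

(** ** Fourier coefficients on circles *)

(** Continuity of [F'] is part of the notion because [F'] occurs under integrals, both when
    integrating by parts and when differentiating in the radius. *)
Definition holo (F F' : C -> C) : Prop :=
  forall z, disk z ->
    cderiv F z (F' z) /\ @continuous C_UniformSpace C_UniformSpace F' z.

Lemma Cmod_circle (t u : R) : Cmod (RtoC t * cis u) = Rabs t.
Proof. rewrite Cmod_mult, Cmod_cis, Cmod_R. ring. Qed.

Lemma disk_circle (t u : R) : -1 < t < 1 -> disk (RtoC t * cis u)%C.
Proof. intros H. unfold disk. rewrite Cmod_circle. apply Rabs_def1; lra. Qed.

Lemma continuous_circle (t u : R) :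
  @continuous (prod_UniformSpace R_UniformSpace R_UniformSpace) C_UniformSpace
    (fun p => RtoC (fst p) * cis (snd p))%C (t, u).
Proof.
  apply continuous_Cmult.
  - apply continuous_C_parts; simpl.
    + apply continuous_fst.
    + apply continuous_const.
  - apply (continuous_comp (V := R_UniformSpace) snd cis).
    + apply continuous_snd.
    + simpl. generalize (ccont_cis 1 u). apply continuous_ext. intros x. f_equal. ring.
Qed.

Lemma continuous_circle_snd (t u : R) :
  @continuous R_UniformSpace C_UniformSpace (fun v => RtoC t * cis v)%C u.
Proof.
  apply continuous_Cmult; [apply continuous_const|].
  generalize (ccont_cis 1 u). apply continuous_ext. intros x. f_equal. ring.
Qed.

(** [2 pi] times the [m]-th Fourier coefficient of [F] on the circle of radius [t]. *)
Definition circ_int (F : C -> C) (m : Z) (t : R) : C :=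
  cint (fun u => F (RtoC t * cis u) * cis (- IZR m * u))%C.

Lemma ccont_circle (F : C -> C) (t : R) : -1 < t < 1 ->
  (forall z, disk z -> @continuous C_UniformSpace C_UniformSpace F z) ->
  ccont (fun u => F (RtoC t * cis u)%C).
Proof.
  intros Ht H u.
  apply (continuous_comp (V := C_UniformSpace) (fun v => RtoC t * cis v)%C F).
  - apply continuous_circle_snd.
  - apply H, disk_circle, Ht.
Qed.

Lemma holo_continuous (F F' : C -> C) : holo F F' ->
  forall z, disk z -> @continuous C_UniformSpace C_UniformSpace F z.
Proof. intros H z Hz. destruct (H z Hz) as [H1 _]. eapply cderiv_continuous, H1. Qed.

(** The derivative in [s] of [F(t e^(is)) e^(-ims)] is [i t A - i m B], with [A] and [B] the two
    integrands; its integral over a full period vanishes. The radius [t = 0] is included on purpose: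
    [circ_int_cis] uses it. *)
Lemma circ_int_by_parts (F F' : C -> C) (m : Z) (t : R) :
  holo F F' -> -1 < t < 1 ->
  (RtoC t * cint (fun u => cis u * F' (RtoC t * cis u) * cis (- IZR m * u)))%C
  = (RtoC (IZR m) * circ_int F m t)%C.
Proof.
  intros HF Ht.
  pose proof (ccont_circle F t Ht (holo_continuous F F' HF)) as C1.
  pose proof (ccont_circle F' t Ht (fun z Hz => proj2 (HF z Hz))) as C2.
  pose proof (ccont_cis (- IZR m)) as C3.
  assert (C4 : ccont cis).
  { intros u. generalize (ccont_cis 1 u). apply continuous_ext. intros x. f_equal. ring. }
  set (A := fun u => (cis u * F' (RtoC t * cis u) * cis (- IZR m * u))%C).
  set (B := fun u => (F (RtoC t * cis u) * cis (- IZR m * u))%C).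
  assert (CA : ccont A) by (apply (ccont_mult (fun u => cis u * F' (RtoC t * cis u))%C); auto;
    apply (ccont_mult cis); auto).
  assert (CB : ccont B) by (apply (ccont_mult (fun u => F (RtoC t * cis u))%C); auto).
  assert (D : forall s, curve_deriv B s (Ci * RtoC t * A s + - Ci * RtoC (IZR m) * B s)%C).
  { intros s. destruct (HF _ (disk_circle t s Ht)) as [HFs _].
    assert (D1 : curve_deriv (fun u => RtoC t * cis u)%C s (RtoC t * (Ci * cis s))%C).
    { pose proof (curve_deriv_mult _ _ s _ _ (curve_deriv_const (RtoC t) s)
        (curve_deriv_cis 1 s)) as P.
      replace (RtoC t * (Ci * cis s))%C
        with (0 * cis (1 * s) + RtoC t * (Ci * 1 * cis (1 * s)))%C
        by (rewrite (Rmult_1_l s); ring).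
      destruct P as [P1 P2]. split; [revert P1|revert P2]; apply is_derive_ext;
        intros u; rewrite (Rmult_1_l u); auto. }
    pose proof (curve_deriv_mult _ _ s _ _ (curve_deriv_comp F _ s _ _ HFs D1)
      (curve_deriv_cis (- IZR m) s)) as P.
    unfold B, A. 
    replace (Ci * RtoC t * (cis s * F' (RtoC t * cis s) * cis (- IZR m * s)) +
      - Ci * RtoC (IZR m) * (F (RtoC t * cis s) * cis (- IZR m * s)))%C
      with (F' (t * cis s) * (t * (Ci * cis s)) * cis (- IZR m * s) +
       F (t * cis s) * (Ci * (- IZR m)%R * cis (- IZR m * s)))%C; [exact P|].
    rewrite RtoC_opp. ring. }
  assert (I : cint (fun s => Ci * RtoC t * A s + - Ci * RtoC (IZR m) * B s)%C = 0%C).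
  { rewrite (cint_deriv B) by (auto; apply ccont_plus; apply ccont_scal; auto).
    unfold B.
    replace (- IZR m * (2 * PI)) with (IZR (- m) * (2 * PI)) by (rewrite opp_IZR; ring).
    rewrite cis_Z_period, Rmult_0_r, cis_0.
    replace (cis (2 * PI)) with (RtoC 1); [ring|].
    replace (2 * PI) with (IZR 1 * (2 * PI)) by ring. symmetry. apply cis_Z_period. }
  rewrite cint_plus, !cint_scal in I by (auto; apply ccont_scal; auto).
  fold B. unfold circ_int. fold B.
  replace (RtoC t * cint A)%C with
    (- Ci * (Ci * RtoC t * cint A + - Ci * RtoC (IZR m) * cint B) +
      RtoC (IZR m) * cint B)%C.
  - rewrite I. ring.
  - assert (Ci * Ci = -1)%C as Hi by (apply C_ext; simpl; ring).
    replace (- Ci * (Ci * RtoC t * cint A + - Ci * RtoC (IZR m) * cint B) +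
      RtoC (IZR m) * cint B)%C with
     (- (Ci * Ci) * (RtoC t * cint A) + (Ci * Ci) * (RtoC (IZR m) * cint B) + RtoC (IZR m) * cint B)%C
      by ring.
    rewrite Hi. ring.
Qed.

Lemma circ_int_deriv (F F' : C -> C) (m : Z) (t : R) :
  holo F F' -> -1 < t < 1 ->
  curve_deriv (circ_int F m) t
    (cint (fun u => cis u * F' (RtoC t * cis u) * cis (- IZR m * u))%C).
Proof.
  intros HF Ht.
  set (f := fun s u => (F (RtoC s * cis u) * cis (- IZR m * u))%C).
  set (f' := fun s u => (cis u * F' (RtoC s * cis u) * cis (- IZR m * u))%C).
  assert (D : forall s u, -1 < s < 1 -> curve_deriv (fun v => f v u) s (f' s u)).
  { intros s u Hs. destruct (HF _ (disk_circle s u Hs)) as [HFs _].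
    pose proof (curve_deriv_mult _ _ s _ _ (curve_deriv_RtoC s)
      (curve_deriv_const (cis u) s)) as P.
    pose proof (curve_deriv_mult _ _ s _ _ (curve_deriv_comp F _ s _ _ HFs P)
      (curve_deriv_const (cis (- IZR m * u)) s)) as P'.
    unfold f, f'.
    replace (cis u * F' (RtoC s * cis u) * cis (- IZR m * u))%C with
      (F' (s * cis u) * (1 * cis u + s * 0) * cis (- IZR m * u) + F (s * cis u) * 0)%C
      by ring. exact P'. }
  assert (CF : forall s, -1 < s < 1 -> ccont (f s)).
  { intros s Hs. apply ccont_mult; [|apply ccont_cis].
    apply ccont_circle; auto. apply (holo_continuous F F' HF). }
  assert (C2 : forall s u, -1 < s < 1 ->
    @continuous (prod_UniformSpace R_UniformSpace R_UniformSpace) C_UniformSpace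
      (fun p => f' (fst p) (snd p)) (s, u)).
  { intros s u Hs. unfold f'. apply continuous_Cmult; [apply continuous_Cmult|].
    - apply (continuous_comp (V := R_UniformSpace) snd cis); [apply continuous_snd|].
      simpl. generalize (ccont_cis 1 u). apply continuous_ext. intros x. f_equal. ring.
    - apply (continuous_comp (V := C_UniformSpace)
        (fun p : R * R => RtoC (fst p) * cis (snd p))%C F').
      + apply continuous_circle.
      + apply HF, disk_circle, Hs.
    - apply (continuous_comp (V := R_UniformSpace) snd (fun v => cis (- IZR m * v)));
        [apply continuous_snd|]. apply ccont_cis. }
  split.
  - apply (is_derive_RInt_strip (fun s u => Re (f s u)) (fun s u => Re (f' s u))
      0 (2 * PI) (-1) 1 t); auto.
    + intros s u Hs. apply D, Hs.
    + intros s u Hs. apply (continuous_Re _ _ (C2 s u Hs)).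
    + intros s u Hs. apply (continuous_Re _ _ (CF s Hs u)).
  - apply (is_derive_RInt_strip (fun s u => Im (f s u)) (fun s u => Im (f' s u))
      0 (2 * PI) (-1) 1 t); auto.
    + intros s u Hs. apply D, Hs.
    + intros s u Hs. apply (continuous_Im _ _ (C2 s u Hs)).
    + intros s u Hs. apply (continuous_Im _ _ (CF s Hs u)).
Qed.

(** By the equation, [u(x) x^(-m)] has derivative zero. *)
Lemma euler_ode (u d : R -> R) (m : R) :
  (forall t, 0 < t < 1 -> is_derive u t (d t) /\ t * d t = m * u t) ->
  forall s t, 0 < s < 1 -> 0 < t < 1 ->
  u s * Rpower s (- m) = u t * Rpower t (- m).
Proof.
  intros H.
  assert (A : forall s t, 0 < s -> s < t -> t < 1 ->
    u s * Rpower s (- m) = u t * Rpower t (- m)).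
  { intros s t Hs Hst Ht.
    apply (eq_is_derive (V := R_NormedModule) (fun x => u x * Rpower x (- m))); auto.
    intros x Hx. destruct (H x ltac:(lra)) as [H1 H2].
    assert (H3 : is_derive (fun x => Rpower x (- m)) x (- m / x * Rpower x (- m))).
    { unfold Rpower. auto_derive; [lra|]. field. lra. }
    pose proof (is_derive_mult _ _ _ _ _ H1 H3 Rmult_comm) as P.
    refine (eq_rect _ (is_derive _ x) P _ _).
    unfold plus, mult, zero; simpl.
    replace (d x) with (m * u x / x) by (rewrite <- H2; field; lra). field. lra. }
  intros s t Hs Ht. destruct (Rtotal_order s t) as [L|[->|L]]; auto.
  - apply A; lra.
  - symmetry. apply A; lra.
Qed.

(** Both components of [circ_int F m] solve Euler's equation. [Rpower] is used since [m] may be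
    negative, and the constant is read off at [t = 1/2]. *)
Lemma circ_int_power (F F' : C -> C) (m : Z) : holo F F' ->
  exists c, forall t, 0 < t < 1 ->
    circ_int F m t = (RtoC (2 * PI) * (RtoC (Rpower t (IZR m)) * c))%C.
Proof.
  intros HF.
  set (p := fun t => Re (circ_int F m t)). set (q := fun t => Im (circ_int F m t)).
  set (k := Rpower (/ 2) (- IZR m)).
  pose proof PI_RGT_0 as HPI.
  exists (p (/ 2) * k / (2 * PI), q (/ 2) * k / (2 * PI)). intros t Ht.
  set (J' := fun t => cint (fun u => cis u * F' (RtoC t * cis u) * cis (- IZR m * u))%C).
  assert (E : forall s, 0 < s < 1 -> (RtoC s * J' s = RtoC (IZR m) * circ_int F m s)%C).
  { intros s Hs. apply circ_int_by_parts; auto. lra. }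
  assert (Ep := euler_ode p (fun s => Re (J' s)) (IZR m)).
  assert (Eq := euler_ode q (fun s => Im (J' s)) (IZR m)).
  specialize (Ep ltac:(intros s Hs; split;
    [apply (circ_int_deriv F F' m s HF ltac:(lra))
    |unfold p; rewrite <- !re_scal_l, E; auto]) (/ 2) t ltac:(lra) Ht).
  specialize (Eq ltac:(intros s Hs; split;
    [apply (circ_int_deriv F F' m s HF ltac:(lra))
    |unfold q; rewrite <- !im_scal_l, E; auto]) (/ 2) t ltac:(lra) Ht).
  fold k in Ep, Eq. rewrite Ep, Eq.
  assert (K : Rpower t (- IZR m) * Rpower t (IZR m) = 1).
  { rewrite <- Rpower_plus, Rplus_opp_l. apply Rpower_O. lra. }
  apply C_ext; [rewrite !re_scal_l|rewrite !im_scal_l]; simpl.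
  - fold (p t). transitivity (p t * (Rpower t (- IZR m) * Rpower t (IZR m))).
    + rewrite K, Rmult_1_r. reflexivity.
    + field. lra.
  - fold (q t). transitivity (q t * (Rpower t (- IZR m) * Rpower t (IZR m))).
    + rewrite K, Rmult_1_r. reflexivity.
    + field. lra.
Qed.

(** Integration by parts for the constant function 1 at radius 0 reads [0 = m * integral]. *)
Lemma circ_int_cis (m : Z) : m <> 0%Z -> cint (fun u => cis (- IZR m * u)) = 0%C.
Proof.
  intros Hm.
  assert (H : holo (fun _ => 1%C) (fun _ => 0%C)).
  { intros z _. split; [apply cderiv_const|apply continuous_const]. }
  pose proof (circ_int_by_parts _ _ m 0 H ltac:(lra)) as E.
  rewrite Cmult_0_l in E. unfold circ_int in E.
  rewrite (cint_ext _ (fun u => cis (- IZR m * u))) in E by (intros u; ring).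
  destruct (Ceq_dec (cint (fun u => cis (- IZR m * u))) 0) as [|N]; auto.
  exfalso. symmetry in E. revert E. apply Cmult_neq_0; auto.
  intros E. apply RtoC_inj in E. apply Hm. apply eq_IZR. exact E.
Qed.

(** The radius [1/2] is an arbitrary choice: for holomorphic [F] every radius in [(0, 1)] gives the
    same value, the Laurent coefficient of index [m]. *)
Definition fourier_coef (F : C -> C) (m : Z) : C :=
  (/ RtoC (2 * PI) * (RtoC (Rpower (/ 2) (- IZR m)) * circ_int F m (/ 2)))%C.

Lemma two_PI_neq_0 : RtoC (2 * PI) <> 0%C.
Proof. intros E. apply RtoC_inj in E. pose proof PI_RGT_0. lra. Qed.

Lemma circ_int_fourier_coef (F F' : C -> C) (m : Z) (t : R) : holo F F' -> 0 < t < 1 ->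
  circ_int F m t = (RtoC (2 * PI) * (RtoC (Rpower t (IZR m)) * fourier_coef F m))%C.
Proof.
  intros HF Ht. destruct (circ_int_power F F' m HF) as [c Hc].
  rewrite (Hc t Ht). do 2 f_equal. unfold fourier_coef. rewrite Hc by lra.
  assert (K : (RtoC (Rpower (/ 2) (- IZR m)) * RtoC (Rpower (/ 2) (IZR m)) = 1)%C).
  { rewrite <- RtoC_mult, <- Rpower_plus, Rplus_opp_l, Rpower_O by lra. auto. }
  pose proof two_PI_neq_0.
  replace (/ RtoC (2 * PI) * (RtoC (Rpower (/ 2) (- IZR m)) *
    (RtoC (2 * PI) * (RtoC (Rpower (/ 2) (IZR m)) * c))))%C
   with ((/ RtoC (2 * PI) * RtoC (2 * PI)) *
     (RtoC (Rpower (/ 2) (- IZR m)) * RtoC (Rpower (/ 2) (IZR m))) * c)%C by ring.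
  rewrite K, Cinv_l by auto. ring.
Qed.

Lemma circ_int_fourier_coef_nat (F F' : C -> C) (n : nat) (t : R) : holo F F' -> 0 < t < 1 ->
  circ_int F (Z.of_nat n) t = (RtoC (2 * PI) * (RtoC (t ^ n) * fourier_coef F (Z.of_nat n)))%C.
Proof.
  intros HF Ht. rewrite (circ_int_fourier_coef F F') by auto.
  rewrite <- INR_IZR_INZ, Rpower_pow by lra. auto.
Qed.

(** This replaces passages to the limit [t -> 0]. *)
Lemma Rle_0_of_small (x M : R) : (forall t, 0 < t <= / 2 -> x <= M * t) -> x <= 0.
Proof.
  intros H. apply Rnot_lt_le. intros Hx.
  pose proof (Rabs_pos M). pose proof (Rle_abs M).
  (* Chosen so that [M * t <= x / 2], which contradicts [x <= M * t] for [x > 0]. *)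
  set (t := Rmin (/ 2) (x / (2 * (Rabs M + 1)))).
  assert (0 < x / (2 * (Rabs M + 1))) by (apply Rdiv_lt_0_compat; lra).
  assert (Ht : 0 < t <= / 2).
  { split; [apply Rmin_pos; lra|apply Rmin_l]. }
  pose proof (H t Ht).
  assert (t <= x / (2 * (Rabs M + 1))) by apply Rmin_r.
  assert (t * (2 * (Rabs M + 1)) <= x).
  { apply (Rmult_le_compat_r (2 * (Rabs M + 1))) in H4; [|lra].
    unfold Rdiv in H4. rewrite Rmult_assoc, Rinv_l, Rmult_1_r in H4 by lra. auto. }
  nra.
Qed.

Lemma circ_int_bound (F F' : C -> C) (m : Z) (t : R) : holo F F' ->
  (forall z, disk z -> Cmod (F z) <= 1) -> -1 < t < 1 ->
  Cmod (circ_int F m t) <= 4 * PI * 1.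
Proof.
  intros HF H1 Ht. apply Cmod_cint_le.
  - apply ccont_mult; [|apply ccont_cis].
    apply ccont_circle; auto. apply (holo_continuous F F' HF).
  - intros u. rewrite Cmod_mult, Cmod_cis, Rmult_1_r. apply H1, disk_circle, Ht.
Qed.

(** The integral [2 pi t^m c] stays bounded by [4 pi] as [t -> 0], so [|c| <= 2 t^(-m) <= 2 t]. *)
Lemma fourier_coef_neg (F F' : C -> C) (m : Z) : holo F F' ->
  (forall z, disk z -> Cmod (F z) <= 1) -> (m < 0)%Z -> fourier_coef F m = 0%C.
Proof.
  intros HF H1 Hm. apply Cmod_eq_0. apply Rle_antisym; [|apply Cmod_ge_0].
  apply Rle_0_of_small with 2. intros t Ht.
  pose proof PI_RGT_0.
  pose proof (circ_int_bound F F' m t HF H1 ltac:(lra)) as B.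
  rewrite (circ_int_fourier_coef F F') in B by (auto; lra).
  rewrite !Cmod_mult, !Cmod_R, (Rabs_pos_eq (2 * PI)) in B by lra.
  assert (P : 0 < Rpower t (IZR m)) by apply exp_pos.
  rewrite (Rabs_pos_eq (Rpower t (IZR m))) in B by lra.
  assert (Q : Rpower t (IZR m) * Rpower t (- IZR m) = 1).
  { rewrite <- Rpower_plus, Rplus_opp_r. apply Rpower_O. lra. }
  assert (T : Rpower t (- IZR m) <= t).
  { rewrite <- opp_IZR. replace (- m)%Z with (Z.of_nat (S (Z.to_nat (- m - 1)))) by lia.
    rewrite <- INR_IZR_INZ, Rpower_pow by lra. simpl.
    rewrite <- (Rmult_1_r t) at 3. apply Rmult_le_compat_l; [lra|].
    rewrite <- (pow1 (Z.to_nat (- m - 1))). apply pow_incr. lra. }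
  assert (B' : Rpower t (IZR m) * Cmod (fourier_coef F m) <= 2) by nra.
  pose proof (Cmod_ge_0 (fourier_coef F m)).
  replace (Cmod (fourier_coef F m)) with
    (Rpower t (IZR m) * Cmod (fourier_coef F m) * Rpower t (- IZR m))
    by (rewrite Rmult_assoc, (Rmult_comm (Cmod _)), <- Rmult_assoc, Q; ring).
  assert (0 < Rpower t (- IZR m)) by apply exp_pos.
  apply Rmult_le_compat; auto; nra.
Qed.

(** * Coefficient bounds by positivity *)

Lemma unimodular_rotation (z : C) : exists u, Cmod u = 1 /\ (u * z)%C = RtoC (Cmod z).
Proof.
  destruct (Ceq_dec z 0) as [->|Hz].
  - exists 1%C. rewrite Cmod_1, Cmod_0. split; auto. ring.
  - assert (Hp := proj1 (Cmod_gt_0 z) Hz).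
    assert (RtoC (Cmod z) <> 0%C) by (intros E; apply RtoC_inj in E; lra).
    exists (Cconj z / RtoC (Cmod z))%C. split.
    + rewrite Cmod_div, Cmod_conj, Cmod_R, Rabs_pos_eq by (auto; lra). field. lra.
    + replace (Cconj z / RtoC (Cmod z) * z)%C with (z * Cconj z / RtoC (Cmod z))%C
        by (field; auto).
      rewrite <- Cmod2_conj, <- RtoC_div by lra. f_equal. field. lra.
Qed.

Lemma Cmod_unit_conj (v : C) : Cmod v = 1 -> (v * Cconj v)%C = 1%C.
Proof. intros H. rewrite <- Cmod2_conj, H. f_equal. ring. Qed.

Lemma cis_opp_conj (x : R) : cis (- x) = Cconj (cis x).
Proof. unfold cis. rewrite cos_neg, sin_neg. auto. Qed.

(** Integrate [Re (1 - u F e^(-i m s))], which is nonnegative, against the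
    nonnegative kernel [2 + 2 Re (v e^(-i n s))]. *)
Lemma circ_int_positivity (F F' : C -> C) (m n : Z) (t : R) (u v : C) : holo F F' ->
  (forall z, disk z -> Cmod (F z) <= 1) -> -1 < t < 1 -> n <> 0%Z ->
  Cmod u = 1 -> Cmod v = 1 -> circ_int F (m - n) t = 0%C ->
  Re (2 * (u * circ_int F m t) + u * v * circ_int F (m + n) t) <= 4 * PI.
Proof.
  intros HF H1 Ht Hn Hu Hv H0.
  pose proof (ccont_circle F t Ht (holo_continuous F F' HF)) as CF.
  set (f := fun s => F (RtoC t * cis s)%C) in *.
  set (e := fun (k : Z) s => cis (- IZR k * s)).
  assert (Ce : forall k, ccont (e k)) by (intros k; apply ccont_cis).
  assert (Cfe : forall k, ccont (fun s => f s * e k s)%C) by (intros k; apply ccont_mult; auto).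
  assert (Ee : forall k l s, (e k s * e l s = e (k + l)%Z s)%C).
  { intros k l s. unfold e. rewrite <- cis_plus, plus_IZR. f_equal. ring. }
  set (K := fun s => ((1 + - u * (f s * e m s)) * (2 + (v * e n s + Cconj v * e (- n)%Z s)))%C).
  (* After expansion, [e n] and [e (-n)] integrate to 0 because [n <> 0], and the term of index
     [m - n] vanishes by hypothesis; only the indices [m] and [m + n] remain. *)
  assert (EK : forall s, K s =
     ((2 + (v * e n s + Cconj v * e (- n)%Z s)) +
      (- (2 * u) * (f s * e m s) + (- (u * v) * (f s * e (m + n)%Z s) +
        - (u * Cconj v) * (f s * e (m - n)%Z s))))%C).
  { intros s. unfold K. rewrite <- !Ee. unfold Z.sub. rewrite <- Ee. ring. }
  assert (I : cint K = (RtoC (4 * PI) + (- (2 * u) * circ_int F m t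
       + (- (u * v) * circ_int F (m + n) t)))%C).
  { rewrite (cint_ext _ _ EK).
    assert (CC : ccont (fun _ => 2%C)) by apply ccont_const.
    assert (Cs : forall (c : C) w, ccont w -> ccont (fun s => c * w s)%C)
      by (intros; apply ccont_scal; auto).
    assert (Cp := ccont_plus).
    rewrite (cint_plus (fun s => 2 + (v * e n s + Cconj v * e (- n)%Z s))%C
      (fun s => - (2 * u) * (f s * e m s) + (- (u * v) * (f s * e (m + n)%Z s) +
        - (u * Cconj v) * (f s * e (m - n)%Z s)))%C)
      by (apply Cp; auto; apply Cp; auto).
    rewrite (cint_plus (fun _ => 2%C)) by auto.
    rewrite (cint_plus (fun s => v * e n s)%C) by auto.
    rewrite (cint_plus (fun s => - (2 * u) * (f s * e m s))%C) by auto.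
    rewrite (cint_plus (fun s => - (u * v) * (f s * e (m + n)%Z s))%C) by auto.
    rewrite (cint_scal v (e n)), (cint_scal (Cconj v) (e (- n)%Z)) by auto.
    rewrite (cint_scal (- (2 * u)) (fun s => f s * e m s)%C) by auto.
    rewrite (cint_scal (- (u * v)) (fun s => f s * e (m + n)%Z s)%C) by auto.
    rewrite (cint_scal (- (u * Cconj v)) (fun s => f s * e (m - n)%Z s)%C) by auto.
    rewrite cint_const. unfold e at 1 2. rewrite !circ_int_cis by lia.
    change (cint (fun s => f s * e (m - n)%Z s)%C) with (circ_int F (m - n) t).
    rewrite H0.
    change (cint (fun s => f s * e m s)%C) with (circ_int F m t).
    change (cint (fun s => f s * e (m + n)%Z s)%C) with (circ_int F (m + n) t).
    replace (4 * PI) with (2 * PI * 2) by ring. rewrite (RtoC_mult (2 * PI) 2). ring. }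
  assert (CK : ccont K).
  { assert (Cs : forall (c : C) w, ccont w -> ccont (fun s => c * w s)%C)
      by (intros; apply ccont_scal; auto).
    apply ccont_mult; apply ccont_plus; try apply ccont_const.
    - apply Cs, Cfe.
    - apply ccont_plus; apply Cs, Ce. }
  assert (P : 0 <= Re (cint K)).
  { apply RInt_ge_0.
    - pose proof PI_RGT_0. lra.
    - apply (ex_RInt_parts K). exact CK.
    - intros s _. unfold K.
      set (y := (v * e n s)%C).
      assert (Ey : (Cconj v * e (- n)%Z s)%C = Cconj y).
      { unfold y, e. rewrite Cmult_conj, <- cis_opp_conj. f_equal. f_equal.
        rewrite opp_IZR. ring. }
      rewrite Ey.
      set (x := (u * (f s * e m s))%C).
      assert (Hx : Cmod x <= 1).
      { unfold x, e. rewrite !Cmod_mult, Cmod_cis, Hu, Rmult_1_l, Rmult_1_r.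
        apply H1, disk_circle, Ht. }
      assert (Hy : Cmod y = 1) by (unfold y, e; rewrite Cmod_mult, Cmod_cis, Hv; ring).
      replace (1 + - u * (f s * e m s))%C with (1 + - x)%C by (unfold x; ring).
      pose proof (re_le_Cmod x) as Rx. pose proof (re_le_Cmod y) as Ry.
      apply Rabs_le_between in Rx, Ry.
      replace (Re ((1 + - x) * (2 + (y + Cconj y)))) with ((1 - Re x) * (2 + 2 * Re y))
        by (destruct x, y; simpl; ring).
      apply Rmult_le_pos; lra. }
  rewrite I in P.
  replace (RtoC (4 * PI) + (- (2 * u) * circ_int F m t + (- (u * v) * circ_int F (m + n) t)))%C
    with (RtoC (4 * PI) + - (2 * (u * circ_int F m t) + u * v * circ_int F (m + n) t))%C
    in P by ring.
  rewrite re_plus, re_opp, re_RtoC in P. lra.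
Qed.

(** The limit [t -> 1], made explicit by Bernoulli's inequality [(1 - s)^n >= 1 - n s]. *)
Lemma Rle_of_Bernoulli (x y : R) (n : nat) : 0 <= x ->
  (forall t, 0 < t < 1 -> t ^ n * x <= y) -> x <= y.
Proof.
  intros Hx H.
  assert (A : x - y <= 0).
  { apply Rle_0_of_small with (INR n * x). intros s Hs.
    specialize (H (1 - s) ltac:(lra)).
    assert (1 - INR n * s <= (1 - s) ^ n).
    { clear H. induction n as [|n IH]; [simpl; lra|]. rewrite S_INR. simpl.
      pose proof (pos_INR n).
      assert ((1 - s) * (1 - INR n * s) <= (1 - s) * (1 - s) ^ n)
        by (apply Rmult_le_compat_l; lra). 
      assert (0 <= INR n * s * s) by (repeat apply Rmult_le_pos; lra). nra. }
    nra. }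
  lra.
Qed.

(** In [circ_int_positivity] the unimodular [u] and [v] are free: [u] turns [c_m] into [|c_m|], and
    [v] is fixed by requiring that [u v] turn [c_(m+n)] into its modulus. Then [t -> 1]. *)
Lemma fourier_coef_bound (F F' : C -> C) (m n : nat) : holo F F' ->
  (forall z, disk z -> Cmod (F z) <= 1) -> (0 < n)%nat ->
  fourier_coef F (Z.of_nat m - Z.of_nat n) = 0%C ->
  Cmod (fourier_coef F (Z.of_nat m)) + Cmod (fourier_coef F (Z.of_nat (m + n))) / 2 <= 1.
Proof.
  intros HF H1 Hn H0.
  set (p := fourier_coef F (Z.of_nat m)). set (q := fourier_coef F (Z.of_nat (m + n))).
  destruct (unimodular_rotation p) as [u [Hu Hup]].
  destruct (unimodular_rotation q) as [w [Hw Hwq]].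
  set (v := (Cconj u * w)%C).
  assert (Hv : Cmod v = 1) by (unfold v; rewrite Cmod_mult, Cmod_conj, Hu, Hw; ring).
  assert (Huv : (u * v = w)%C).
  { unfold v. rewrite Cmult_assoc, Cmod_unit_conj by auto. ring. }
  pose proof (Cmod_ge_0 p). pose proof (Cmod_ge_0 q).
  apply (Rle_of_Bernoulli _ _ (m + n)); [lra|].
  intros t Ht.
  assert (Z0 : circ_int F (Z.of_nat m - Z.of_nat n) t = 0%C).
  { rewrite (circ_int_fourier_coef F F'), H0 by auto. ring. }
  pose proof (circ_int_positivity F F' (Z.of_nat m) (Z.of_nat n) t u v HF H1
    ltac:(lra) ltac:(lia) Hu Hv Z0) as P.
  rewrite <- Nat2Z.inj_add, !(circ_int_fourier_coef_nat F F') in P by auto.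
  fold p q in P.
  replace (2 * (u * (RtoC (2 * PI) * (RtoC (t ^ m) * p))) +
         u * v * (RtoC (2 * PI) * (RtoC (t ^ (m + n)) * q)))%C with
    (RtoC (2 * PI) * (2 * RtoC (t ^ m) * (u * p) + RtoC (t ^ (m + n)) * ((u * v) * q)))%C
    in P by ring.
  rewrite Huv, Hup, Hwq in P. rewrite <- !RtoC_mult, <- RtoC_plus, <- RtoC_mult, re_RtoC in P.
  pose proof PI_RGT_0.
  assert (2 * t ^ m * Cmod p + t ^ (m + n) * Cmod q <= 2) by nra.
  (* The two terms carry different powers of [t]; lowering the first to [t^(m+n)] gives the form
     needed for the limit. *)
  assert (t ^ (m + n) <= t ^ m).
  { rewrite pow_add. assert (0 < t ^ m) by (apply pow_lt; lra).
    assert (t ^ n <= 1) by (rewrite <- (pow1 n); apply pow_incr; lra). nra. }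
  nra.
Qed.

(** * Coefficients of a bounded quotient *)

Lemma csum_scal (c : C) (f : nat -> C) (n : nat) :
  (c * sum_n (G := C_AbelianMonoid) f n)%C = sum_n (G := C_AbelianMonoid) (fun k => c * f k)%C n.
Proof.
  induction n as [|n IH]; [rewrite !sum_O; auto|].
  rewrite !sum_Sn, <- IH. unfold plus; simpl. ring.
Qed.

Lemma csum_last (f : nat -> C) (n : nat) : (forall k, (k < n)%nat -> f k = 0%C) ->
  sum_n (G := C_AbelianMonoid) f n = f n.
Proof.
  destruct n as [|n]; intros H; [apply sum_O|].
  rewrite sum_Sn. replace (sum_n (G := C_AbelianMonoid) f n) with (RtoC 0).
  - unfold plus; simpl. ring.
  - clear -H. induction n as [|n IH].
    + rewrite sum_O, H; auto.
    + rewrite sum_Sn, <- IH by (intros; apply H; lia). rewrite H by lia.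
      unfold plus; simpl. ring.
Qed.

Lemma cint_sum (f : nat -> R -> C) (n : nat) : (forall k, ccont (f k)) ->
  ccont (fun s => sum_n (G := C_AbelianMonoid) (fun k => f k s) n) /\
  cint (fun s => sum_n (G := C_AbelianMonoid) (fun k => f k s) n)
    = sum_n (G := C_AbelianMonoid) (fun k => cint (f k)) n.
Proof.
  intros Hf. induction n as [|n [IH1 IH2]].
  - split.
    + intros s. apply (continuous_ext (f 0%nat)); [intros x; rewrite sum_O; auto|apply Hf].
    + rewrite sum_O. apply cint_ext. intros s. apply sum_O.
  - split.
    + intros s. eapply continuous_ext; [|apply (ccont_plus _ _ IH1 (Hf (S n)))].
      intros x. simpl. rewrite sum_Sn. auto.
    + rewrite sum_Sn, <- IH2.
      rewrite (cint_ext _ (fun s => sum_n (G := C_AbelianMonoid) (fun k => f k s) n + f (S n) s)%C).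
      * apply cint_plus; auto.
      * intros s. rewrite sum_Sn. auto.
Qed.

(** Comparison, as [t -> 0], of the [n]-th Fourier coefficients of the Taylor
    polynomials of [G] and [H] of degree [n]; the error is [O(t^(n+1))]. *)
Lemma fourier_coef_conv (F F' G H : C -> C) (g h : nat -> C) : holo F F' ->
  (forall z, disk z -> Cmod (F z) <= 1) ->
  power_series g G -> power_series h H ->
  (forall z, disk z -> G z = (F z * H z)%C) ->
  forall n, g n = sum_n (G := C_AbelianMonoid)
    (fun k => h k * fourier_coef F (Z.of_nat (n - k)))%C n.
Proof.
  intros HF H1 HG HH E n.
  destruct (power_series_tail g G n HG) as [K1 HK1].
  destruct (power_series_tail h H n HH) as [K2 HK2].
  apply Ceq_minus, Cmod_eq_0, Rle_antisym; [|apply Cmod_ge_0].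
  apply Rle_0_of_small with (2 * (K1 + K2)). intros t Ht.
  set (X := (g n - _)%C).
  set (z := fun s => (RtoC t * cis s)%C).
  set (e := fun s => cis (- IZR (Z.of_nat n) * s)).
  set (A := fun s => sum_n (G := C_AbelianMonoid) (fun k => g k * z s ^ k * e s)%C n).
  set (D := fun s => sum_n (G := C_AbelianMonoid) (fun k => h k * z s ^ k * (F (z s) * e s))%C n).
  assert (Ht1 : -1 < t < 1) by lra.
  assert (Ce : ccont e) by apply ccont_cis.
  assert (Cz : forall k, ccont (fun s => z s ^ k)%C).
  { assert (Cz : ccont z) by (intros s; apply continuous_circle_snd).
    induction k as [|k IH]; simpl; [apply ccont_const|apply ccont_mult; auto]. }
  assert (CF : ccont (fun s => F (z s)))
    by (apply ccont_circle; auto; apply (holo_continuous F F' HF)).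
  destruct (cint_sum (fun k s => g k * z s ^ k * e s)%C n) as [CA IA].
  { intros k. apply ccont_mult; auto. apply ccont_scal; auto. }
  destruct (cint_sum (fun k s => h k * z s ^ k * (F (z s) * e s))%C n) as [CD ID].
  { intros k. apply (ccont_mult (fun s => h k * z s ^ k)%C); [apply ccont_scal; auto|].
    apply ccont_mult; auto. }
  fold A in CA, IA. fold D in CD, ID.
  assert (Zk : forall k s, (k <= n)%nat ->
    (z s ^ k * e s = RtoC (t ^ k) * cis (- IZR (Z.of_nat (n - k)) * s))%C).
  { intros k s Hk. unfold z, e. rewrite Cpow_mult_l, cis_pow, RtoC_pow, <- Cmult_assoc, <- cis_plus.
    do 2 f_equal. rewrite <- !INR_IZR_INZ, minus_INR by auto. ring. }
  (* For [k < n] the factor [e^(-i(n-k)s)] integrates to 0, so only the top term of the Taylor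
     polynomial survives. *)
  assert (VA : cint A = (RtoC (2 * PI) * (RtoC (t ^ n) * g n))%C).
  { rewrite IA, csum_last.
    - rewrite (cint_ext _ (fun s => g n * RtoC (t ^ n))%C).
      + rewrite cint_const. ring.
      + intros s. rewrite <- Cmult_assoc, Zk, Nat.sub_diag by auto. simpl.
        replace (- 0 * s) with 0 by ring. rewrite cis_0. ring.
    - intros k Hk.
      rewrite (cint_ext _ (fun s => g k * RtoC (t ^ k) * cis (- IZR (Z.of_nat (n - k)) * s))%C).
      + rewrite cint_scal by apply ccont_cis. rewrite circ_int_cis by lia. ring.
      + intros s. rewrite <- Cmult_assoc, Zk by lia. ring. }
  assert (VD : cint D = (RtoC (2 * PI) * (RtoC (t ^ n) * sum_n (G := C_AbelianMonoid)
    (fun k => h k * fourier_coef F (Z.of_nat (n - k)))%C n))%C).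
  { rewrite ID, !csum_scal. apply sum_n_ext_loc. intros k Hk.
    rewrite (cint_ext _ (fun s => (h k * RtoC (t ^ k)) *
       (F (z s) * cis (- IZR (Z.of_nat (n - k)) * s)))%C).
    - rewrite cint_scal by (apply ccont_mult; auto; apply ccont_cis).
      change (cint (fun u => F (z u) * cis (- IZR (Z.of_nat (n - k)) * u))%C)
        with (circ_int F (Z.of_nat (n - k)) t).
      rewrite (circ_int_fourier_coef_nat F F') by (auto; lra).
      replace (t ^ n) with (t ^ k * t ^ (n - k)) by (rewrite <- pow_add; f_equal; lia).
      rewrite (RtoC_mult (t ^ k)). match goal with |- ?x = ?y => change (@eq C x y) end. ring.
    - intros s. transitivity (h k * (z s ^ k * e s) * F (z s))%C; [ring|].
      rewrite Zk by auto. ring. }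
  assert (B : Cmod (cint (fun s => A s + -1 * D s)%C) <= 4 * PI * ((K1 + K2) * t ^ S n)).
  { apply Cmod_cint_le.
    - apply ccont_plus; auto. apply ccont_scal; auto.
    - intros s.
      assert (Mz : Cmod (z s) = t) by (unfold z; rewrite Cmod_circle, Rabs_pos_eq; lra).
      assert (Hz : disk (z s)) by (unfold disk; lra).
      specialize (HK1 (z s) ltac:(lra)). specialize (HK2 (z s) ltac:(lra)).
      rewrite Mz in HK1, HK2.
      set (PG := sum_n (G := C_AbelianMonoid) (fun k => g k * z s ^ k)%C n) in *.
      set (PH := sum_n (G := C_AbelianMonoid) (fun k => h k * z s ^ k)%C n) in *.
      assert (EA : A s = (PG * e s)%C).
      { unfold PG. rewrite Cmult_comm, csum_scal. apply sum_n_ext. intros k. apply Cmult_comm. }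
      assert (ED : D s = (PH * F (z s) * e s)%C).
      { unfold PH. rewrite <- Cmult_assoc, Cmult_comm, csum_scal. apply sum_n_ext. intros k. apply Cmult_comm. }
      rewrite EA, ED.
      (* Since [F H = G], the difference of the integrands is made of the two Taylor tails, that of
         [H] multiplied by [F] with [|F| <= 1]. *)
      replace (PG * e s + -1 * (PH * F (z s) * e s))%C with
        ((F (z s) * (H (z s) - PH) + - (F (z s) * H (z s) - PG)) * e s)%C by ring.
      rewrite <- E by auto. rewrite Cmod_mult.
      replace (Cmod (e s)) with 1 by (symmetry; apply Cmod_cis). rewrite Rmult_1_r.
      eapply Rle_trans; [apply Cmod_triangle|]. rewrite Cmod_opp, Cmod_mult.
      pose proof (H1 (z s) Hz). pose proof (Cmod_ge_0 (F (z s))).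
      pose proof (Cmod_ge_0 (H (z s) - PH)). nra. }
  rewrite cint_plus, cint_scal, VA, VD in B by (auto; apply ccont_scal; auto).
  replace (RtoC (2 * PI) * (RtoC (t ^ n) * g n) + -1 * (RtoC (2 * PI) * (RtoC (t ^ n) *
     sum_n (G := C_AbelianMonoid) (fun k => h k * fourier_coef F (Z.of_nat (n - k))) n)))%C
   with (RtoC (2 * PI) * (RtoC (t ^ n) * X))%C in B by (unfold X; ring).
  rewrite !Cmod_mult, !Cmod_R in B. pose proof PI_RGT_0.
  assert (Hp : 0 < t ^ n) by (apply pow_lt; lra).
  rewrite !Rabs_pos_eq in B by lra. simpl in B.
  (* The error is of order [t^(n+1)]: dividing by [2 pi t^n] leaves [|X| <= 2 (K1 + K2) t]. *)
  apply Rmult_le_reg_l with (2 * PI * t ^ n); [nra|]. nra.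
Qed.

(** The interface between function theory and the inequalities: [c] are the Fourier coefficients of
    [G/H], and the last clause is the Schwarz-lemma version of the bound, shifted by one index. *)
Lemma bounded_quotient_coefs (G H : C -> C) (g h : nat -> C) :
  power_series g G -> power_series h H ->
  (forall z, disk z -> H z <> 0%C) ->
  (forall z, disk z -> Cmod (G z) <= Cmod (H z)) ->
  exists c : nat -> C,
    (forall n, g n = sum_n (G := C_AbelianMonoid) (fun k => h k * c (n - k)%nat)%C n) /\
    (forall n, Cmod (c O) + Cmod (c (S n)) / 2 <= 1) /\
    (c O = 0%C -> forall n, Cmod (c 1%nat) + Cmod (c (S (S n))) / 2 <= 1).
Proof.
  intros HG HH H0 Hle.
  destruct (power_series_deriv g G HG) as [G1 [HG1 DG]].
  destruct (power_series_deriv h H HH) as [H1 [HH1 DH]].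
  (* Second derivatives are taken because [holo] requires a continuous derivative of the
     quotient. *)
  destruct (power_series_deriv _ G1 HG1) as [G2 [_ DG1]].
  destruct (power_series_deriv _ H1 HH1) as [H2 [_ DH1]].
  set (F := fun z => (G z / H z)%C).
  set (F' := fun z => ((G1 z * H z - G z * H1 z) / (H z * H z))%C).
  assert (HF : holo F F').
  { intros z Hz. split.
    - apply cderiv_div; auto.
    - pose proof (H0 z Hz).
      eapply cderiv_continuous. apply cderiv_div.
      + apply Cmult_neq_0; auto.
      + apply (cderiv_plus (fun w => G1 w * H w)%C (fun w => - (G w * H1 w))%C).
        * apply cderiv_mult; auto.
        * apply (cderiv_ext_loc (fun w => -1 * (G w * H1 w))%C).
          { exists 1. split; [lra|]. intros; ring. }
          apply cderiv_scal, cderiv_mult; auto.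
      + apply cderiv_mult; auto. }
  assert (HF1 : forall z, disk z -> Cmod (F z) <= 1).
  { intros z Hz. unfold F. rewrite Cmod_div by auto.
    pose proof (proj1 (Cmod_gt_0 _) (H0 z Hz)).
    apply Rmult_le_reg_r with (Cmod (H z)); auto.
    unfold Rdiv. rewrite Rmult_assoc, Rinv_l, Rmult_1_r, Rmult_1_l by lra. auto. }
  exists (fun n => fourier_coef F (Z.of_nat n)). repeat split.
  - apply (fourier_coef_conv F F' G H); auto.
    intros z Hz. unfold F. field. auto.
  - intros n. apply (fourier_coef_bound F F' 0 (S n)); auto; [lia|].
    apply (fourier_coef_neg F F'); auto. lia.
  - intros Hc n. apply (fourier_coef_bound F F' 1 (S n)); auto; [lia|].
    (* The index [1 - (n + 1)] is 0 for [n = 0], covered by the hypothesis on [c 0], and negative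
       otherwise. *)
    destruct n as [|n]; [exact Hc|].
    apply (fourier_coef_neg F F'); auto. lia.
Qed.

(** ** Bohr-type inequalities *)

Lemma sum_n_RSn (u : nat -> R) (n : nat) : sum_n u (S n) = sum_n u n + u (S n).
Proof. rewrite sum_Sn. auto. Qed.

Lemma sum_n_Rmult_l (c : R) (u : nat -> R) (n : nat) :
  sum_n (fun k => c * u k) n = c * sum_n u n.
Proof. apply (sum_n_mult_l (K := R_Ring)). Qed.

Lemma sum_n_Rplus (u v : nat -> R) (n : nat) :
  sum_n (fun k => u k + v k) n = sum_n u n + sum_n v n.
Proof. apply (sum_n_plus (G := R_AbelianMonoid)). Qed.

Lemma sum_n_le_loc (u v : nat -> R) (n : nat) :
  (forall k, (k <= n)%nat -> u k <= v k) -> sum_n u n <= sum_n v n.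
Proof.
  intros H. induction n as [|n IH]; [rewrite !sum_O; auto|].
  rewrite !sum_n_RSn. apply Rplus_le_compat; auto.
Qed.

Lemma sum_n_nonneg (u : nat -> R) (n : nat) : (forall k, 0 <= u k) -> 0 <= sum_n u n.
Proof.
  intros H. eapply Rle_trans; [apply (H O)|].
  apply sum_n_nonneg_ge; [auto|lia].
Qed.

Lemma sum_n_first (f : nat -> C) (n : nat) :
  sum_n (G := C_AbelianMonoid) f (S n)
  = (f O + sum_n (G := C_AbelianMonoid) (fun k => f (S k)) n)%C.
Proof.
  induction n as [|n IH].
  - rewrite sum_Sn, !sum_O. auto.
  - rewrite sum_Sn, IH, sum_Sn. unfold plus; simpl. ring.
Qed.

Lemma sum_n_first_R (f : nat -> R) (n : nat) :
  sum_n f (S n) = f O + sum_n (fun k => f (S k)) n.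
Proof.
  induction n as [|n IH].
  - rewrite sum_n_RSn, !sum_O. auto.
  - rewrite sum_n_RSn, IH, sum_n_RSn. apply Rplus_assoc.
Qed.

(** The index pairs on the left form a triangle inside the square on the right, and all terms are
    nonnegative. *)
Lemma sum_n_conv_le (x y : nat -> R) (N : nat) :
  (forall n, 0 <= x n) -> (forall n, 0 <= y n) ->
  sum_n (fun n => sum_n (fun k => x k * y (n - k)%nat) n) N <= sum_n x N * sum_n y N.
Proof.
  intros Hx Hy.
  assert (E : sum_n (fun n => sum_n (fun k => x k * y (n - k)%nat) n) N
     = sum_n (fun k => x k * sum_n y (N - k)) N).
  { induction N as [|N IH].
    - rewrite !sum_O. simpl. rewrite ?sum_O. auto.
    - rewrite (sum_n_RSn _ N), IH, !sum_n_RSn, Nat.sub_diag, sum_O.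
      rewrite <- Rplus_assoc, <- sum_n_Rplus. f_equal. apply sum_n_ext_loc. intros k Hk.
      replace (S N - k)%nat with (S (N - k)) by lia. rewrite sum_n_RSn. 
      match goal with |- ?a = ?b => change (@eq R a b) end. ring. }
  rewrite E, Rmult_comm, <- sum_n_Rmult_l. apply sum_n_le_loc. intros k Hk.
  rewrite Rmult_comm. apply Rmult_le_compat_r; auto.
  replace N with (N - k + k)%nat at 2 by lia. generalize (N - k)%nat. clear -Hy.
  intros n. induction k as [|k IH].
  - rewrite Nat.add_0_r. lra.
  - rewrite Nat.add_succ_r, sum_n_RSn. specialize (Hy (S (n + k))). lra.
Qed.

(** Each later coefficient is at most [2 (1 - c_0)], and [2 (3^(-1) + ... + 3^(-N)) = 1 - 3^(-N)];
    this explains the strengthened bound proved by induction. *)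
Lemma bohr_partial_sums (c : nat -> R) (r : R) :
  (forall n, c O + c (S n) / 2 <= 1) -> c O <= 1 -> 0 <= r <= / 3 ->
  forall N, sum_n (fun n => c n * r ^ n) N <= 1.
Proof.
  intros Hc H0 Hr N.
  assert (A : sum_n (fun n => c n * r ^ n) N <= 1 - (1 - c O) * (/ 3) ^ N).
  { induction N as [|N IH]; [rewrite sum_O; simpl; lra|].
    rewrite sum_n_RSn. specialize (Hc N).
    assert (P : 0 <= r ^ S N <= (/ 3) ^ S N).
    { split; [apply pow_le; lra|apply pow_incr; lra]. }
    assert (c (S N) * r ^ S N <= 2 * (1 - c O) * (/ 3) ^ S N).
    { apply Rle_trans with (2 * (1 - c O) * r ^ S N).
      - apply Rmult_le_compat_r; lra.
      - apply Rmult_le_compat_l; lra. }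
    replace ((/ 3) ^ N) with (3 * (/ 3) ^ S N) in IH by (simpl; field).
    lra. }
  assert (0 <= (/ 3) ^ N) by (apply pow_le; lra). nra.
Qed.

Lemma is_series_le_of_partial_sums (u : nat -> R) (l M : R) :
  is_series u l -> (forall N, sum_n u N <= M) -> l <= M.
Proof.
  intros H HM.
  apply (is_lim_seq_le (sum_n u) (fun _ => M) l M); auto. apply is_lim_seq_const.
Qed.

Lemma Series_le_of_partial_sums (u : nat -> R) (M : R) :
  (forall n, 0 <= u n) -> (forall N, sum_n u N <= M) -> Series u <= M.
Proof.
  intros Hu HM.
  assert (E : ex_finite_lim_seq (sum_n u)).
  { apply ex_finite_lim_seq_incr with M; auto.
    intros n. rewrite sum_n_RSn. specialize (Hu (S n)). lra. }
  destruct E as [l Hl].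
  rewrite (is_series_unique u l) by exact Hl.
  apply (is_series_le_of_partial_sums u); auto.
Qed.

Lemma power_series_affine (a : nat -> C) (F : C -> C) (c d : C) : power_series a F ->
  power_series (fun n => match n with O => c + d * a O | S _ => d * a n end)%C
    (fun z => c + d * F z)%C.
Proof.
  intros H z Hz. pose proof (Cseries_decr _ _ (H z Hz)) as H1.
  apply (Cseries_scal d) in H1. simpl in H1.
  replace (c + d * F z)%C with ((c + d * a O) * z ^ 0 + d * (F z - a O * 1))%C
    by (simpl; ring).
  apply (Cseries_incr (fun n => match n with O => c + d * a O | S _ => d * a n end * z ^ n)%C).
  eapply Cseries_ext; [|exact H1]. intros n. simpl. ring.
Qed.

Lemma Cmod_sqr (z : C) : Cmod z * Cmod z = Re z * Re z + Im z * Im z.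
Proof. pose proof (Cmod2_alt z). simpl in H. lra. Qed.

(** If [w (1 - conj p h) = p - h] with [|w| <= r], then [h = (p - w)/(1 - conj p w)]. *)
Lemma mobius_bound (p w h : C) (r : R) : Cmod p < 1 -> Cmod w <= r -> r < 1 ->
  (w * (1 - Cconj p * h) = p - h)%C -> Cmod h <= (Cmod p + r) / (1 + Cmod p * r).
Proof.
  intros Hp Hw Hr E.
  assert (Hh : (h * (1 - Cconj p * w) = p - w)%C).
  { replace (h * (1 - Cconj p * w))%C with (w * (1 - Cconj p * h) + (h - w))%C by ring.
    rewrite E. ring. }
  pose proof (Cmod_ge_0 p) as P0. pose proof (Cmod_ge_0 w) as W0.
  set (A := Cmod p) in *. set (s := Cmod w) in *.
  set (x := Re (Cconj p * w)%C).
  assert (Hx : - (A * s) <= x).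
  { pose proof (re_le_Cmod (Cconj p * w)) as R. rewrite Cmod_mult, Cmod_conj in R.
    fold A s x in R. apply Rabs_le_between in R. lra. }
  pose proof (Cmod_sqr p) as Sp. pose proof (Cmod_sqr w) as Sw. fold A in Sp. fold s in Sw.
  set (P := Cmod (1 - Cconj p * w)).
  assert (EP : P * P = 1 + A * A * (s * s) - 2 * x).
  { unfold P. rewrite Cmod_sqr, Sp, Sw. unfold x. destruct p, w; simpl. ring. }
  assert (EN : Cmod (p - w) * Cmod (p - w) = A * A + s * s - 2 * x).
  { rewrite Cmod_sqr, Sp, Sw. unfold x. destruct p, w; simpl. ring. }
  assert (HP : 1 - A * s <= P).
  { unfold P. pose proof (Cmod_triangle_rev 1 (Cconj p * w)) as T.
    rewrite Cmod_1, Cmod_mult, Cmod_conj in T. exact T. }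
  assert (Hs : A * s < 1) by nra.
  apply (f_equal Cmod) in Hh. rewrite Cmod_mult in Hh. fold P in Hh.
  assert (D : 0 < 1 + A * r) by nra.
  apply Rmult_le_reg_r with (1 + A * r); auto.
  unfold Rdiv. rewrite Rmult_assoc, Rinv_l, Rmult_1_r by lra.
  pose proof (Cmod_ge_0 h) as H0.
  apply Rmult_le_reg_r with P; [lra|].
  replace (Cmod h * (1 + A * r) * P) with (Cmod (p - w) * (1 + A * r)) by (rewrite <- Hh; ring).
  set (N := Cmod (p - w)) in *.
  assert (HN : 0 <= N) by apply Cmod_ge_0.
  apply Rsqr_incr_0_var; [|apply Rmult_le_pos; lra]. unfold Rsqr.
  replace (N * (1 + A * r) * (N * (1 + A * r))) with (N * N * ((1 + A * r) * (1 + A * r))) by ring.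
  replace ((A + r) * P * ((A + r) * P)) with (P * P * ((A + r) * (A + r))) by ring.
  (* The modulus of [1 - conj p w] is largest when [conj p w] is negative and [|w| = r]. *)
  assert (PP : P * P <= (1 + A * r) * (1 + A * r)).
  { assert (0 <= A * s <= A * r) by (split; [apply Rmult_le_pos|apply Rmult_le_compat_l]; lra).
    rewrite EP. nra. }
  (* The identity [|1 - conj p w|^2 - |p - w|^2 = (1 - |p|^2)(1 - |w|^2)]; its instance with real
     values [-p], [r] in place of [p], [w] expresses the bound sought. *)
  replace (N * N) with (P * P - (1 - A * A) * (1 - s * s)) by (rewrite EN, EP; ring).
  assert (K1 : (1 - r * r) * (P * P) <= (1 - s * s) * ((1 + A * r) * (1 + A * r))).
  { assert (0 <= s * s <= r * r) by nra. apply Rmult_le_compat; nra. }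
  assert (K2 : 0 <= 1 - A * A) by nra.
  apply (Rmult_le_compat_l (1 - A * A)) in K1; auto. lra.
Qed.

(** With [W = (h(0) - h)/(1 - conj h(0) h) = sum c_n z^n], one has [c_0 = 0] and
    [sum |c_n| r^n <= r] for [r <= 1/3]; both bounds follow from
    [W (1 - conj h(0) h) = h(0) - h]. *)
Lemma schur_bounds (a : nat -> C) (h : C -> C) (r : R) : power_series a h ->
  (forall z, disk z -> Cmod (h z) < 1) -> Cmod (a O) < 1 -> 0 <= r <= / 3 ->
  (forall z, Cmod z = r -> Cmod (h z) <= (Cmod (a O) + r) / (1 + Cmod (a O) * r)) /\
  (forall N, sum_n (fun n => Cmod (a (S n)) * r ^ S n) N
     <= (1 - Cmod (a O) ^ 2) * r / (1 - Cmod (a O) * r)).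
Proof.
  intros Ha Hh Hp Hr. set (p := a O) in *. set (A := Cmod p) in *.
  assert (A0 : 0 <= A) by apply Cmod_ge_0.
  pose proof (power_series_affine a h p (-1) Ha) as PG.
  pose proof (power_series_affine a h 1 (- Cconj p) Ha) as PH.
  assert (NZ : forall z, disk z -> 0 < Cmod (1 + - Cconj p * h z)).
  { intros z Hz. pose proof (Cmod_triangle_rev 1 (Cconj p * h z)) as T.
    rewrite Cmod_1, Cmod_mult, Cmod_conj in T. fold A in T.
    replace (1 + - Cconj p * h z)%C with (1 - Cconj p * h z)%C by ring.
    specialize (Hh z Hz). pose proof (Cmod_ge_0 (h z)). nra. }
  destruct (bounded_quotient_coefs _ _ _ _ PG PH) as [c [Hc1 [Hc2 Hc3]]].
  { intros z Hz. apply Cmod_gt_0, NZ, Hz. }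
  { intros z Hz. specialize (Hh z Hz).
    apply Rsqr_incr_0_var; [|apply Cmod_ge_0]. unfold Rsqr.
    rewrite !Cmod_sqr.
    pose proof (Cmod_sqr p) as Sp. fold A in Sp.
    pose proof (Cmod_sqr (h z)) as Sh. pose proof (Cmod_ge_0 (h z)).
    (* This product is [|1 - conj p h|^2 - |p - h|^2]. *)
    assert (0 <= (1 - A * A) * (1 - Cmod (h z) * Cmod (h z))) by (apply Rmult_le_pos; nra).
    rewrite Sp, Sh in *. destruct p, (h z); simpl in *. nra. }
  assert (Hq : (1 + - Cconj p * p)%C = RtoC (1 - A ^ 2)).
  { rewrite RtoC_minus. unfold A. rewrite Cmod2_conj. ring. }
  assert (Q0 : 0 < 1 - A ^ 2) by (simpl; nra).
  assert (C0 : c O = 0%C).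
  { pose proof (Hc1 O) as E. rewrite sum_O in E. simpl in E. fold p in E.
    rewrite Hq in E. replace (p + -1 * p)%C with (RtoC 0) in E by ring.
    destruct (Ceq_dec (c O) 0) as [|N]; auto. symmetry in E. exfalso. revert E.
    apply Cmult_neq_0; auto. intros E. apply RtoC_inj in E. lra. }
  specialize (Hc3 C0).
  set (x := fun n => Cmod (c n) * r ^ n).
  assert (X0 : forall n, 0 <= x n).
  { intros n. apply Rmult_le_pos; [apply Cmod_ge_0|apply pow_le; lra]. }
  assert (XN : forall N, sum_n x N <= r).
  { intros [|N].
    - rewrite sum_O. unfold x. rewrite C0, Cmod_0. lra.
    - rewrite sum_n_first_R. unfold x at 1. rewrite C0, Cmod_0.
      (* Bohr's bound is applied to the shifted sequence; the factor [r] split off from [r^(n+1)]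
         gives the estimate by [r]. *)
      assert (B : sum_n (fun n => Cmod (c (S n)) * r ^ n) N <= 1).
      { apply (bohr_partial_sums (fun n => Cmod (c (S n)))); auto.
        specialize (Hc3 O). pose proof (Cmod_ge_0 (c 2%nat)). lra. }
      rewrite (sum_n_ext _ (fun n => r * (Cmod (c (S n)) * r ^ n)))
        by (intros n; unfold x; simpl; ring).
      rewrite sum_n_Rmult_l. nra. }
  split.
  - intros z Hz.
    assert (Hzd : disk z) by (unfold disk; lra).
    assert (Rc : Rbar_le 1 (abs_radius c)).
    { apply abs_radius_bounded with 2. intros n.
      pose proof (Cmod_ge_0 (c O)). destruct n as [|n]; [specialize (Hc2 O)|specialize (Hc2 n)].
      - pose proof (Cmod_ge_0 (c 1%nat)). lra.
      - lra. }
    pose proof (abs_radius_power_series c Rc z Hzd) as SW. simpl in SW.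
    set (w := Csum (fun n => c n * z ^ n)%C) in SW.
    pose proof (power_series_radius _ _ PH) as RH.
    pose proof (PH z Hzd) as SH.
    match type of PH with power_series ?u _ => set (hc := u) in * end.
    match type of PG with power_series ?u _ => set (gc := u) in * end.
    assert (Hz1 : 0 <= Cmod z < 1) by lra.
    assert (Ab : forall u : nat -> C, Rbar_le 1 (abs_radius u) ->
      ex_series (fun n => Cmod (u n * z ^ n))).
    { intros u Hu. eapply ex_series_ext; [|apply (abs_radius_ex_series u _ Hu Hz1)].
      intros n. simpl. rewrite Cmod_mult, Cmod_pow. auto. }
    pose proof (Cseries_mult _ _ _ _ SH SW (Ab _ RH) (Ab _ Rc)) as SP.
    (* Here [w] is only the sum of [c_n z^n]; the convolution identity and the Cauchy product show
       that it satisfies the equation of [W(z)]. *)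
    assert (E : ((1 + - Cconj p * h z) * w = p + -1 * h z)%C).
    { apply (Cseries_unique (fun n => gc n * z ^ n)%C); [|exact (PG z Hzd)].
      eapply Cseries_ext; [|exact SP]. intros n. cbv beta.
      replace (gc n) with (sum_n (G := C_AbelianMonoid) (fun k => hc k * c (n - k)%nat)%C n)
        by (symmetry; apply Hc1).
      rewrite Cmult_comm, csum_scal. apply sum_n_ext_loc. intros k Hk.
      replace (z ^ n)%C with (z ^ k * z ^ (n - k))%C by (rewrite <- Cpow_add_r; f_equal; lia).
      match goal with |- ?a = ?b => change (@eq C a b) end. ring. }
    apply (mobius_bound p w).
    + exact Hp.
    + eapply Rle_trans.
      * apply (Cmod_series_le _ _ _ _ SW (abs_radius_is_series c r Rc ltac:(lra))).
        intros n. rewrite Cmod_mult, Cmod_pow, Hz. lra.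
      * apply (is_series_le_of_partial_sums x); auto.
        apply (abs_radius_is_series c r Rc). lra.
    + lra.
    + replace (p - h z)%C with (p + -1 * h z)%C by ring. rewrite <- E. ring.
  - intros N. set (y := fun n => Cmod (a (S n)) * r ^ S n).
    assert (Y0 : forall n, 0 <= y n).
    { intros n. apply Rmult_le_pos; [apply Cmod_ge_0|apply pow_le; lra]. }
    (* Coefficient of [z^(n+1)] in [(1 - conj p h) W = p - h]: the constant term [1 - |p|^2] of the
       denominator multiplies [c_(n+1)], the others form a convolution. *)
    assert (Hy : forall n, y n <= (1 - A ^ 2) * x (S n)
       + A * sum_n (fun k => y k * x (n - k)%nat) n).
    { intros n. pose proof (Hc1 (S n)) as E. rewrite sum_n_first in E.
      cbv beta iota in E. fold p in E. rewrite Hq in E.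
      rewrite (sum_n_ext _ (fun k => - Cconj p * (a (S k) * c (n - k)%nat))%C) in E
        by (intros k; simpl Nat.sub; rewrite Cmult_assoc; auto).
      rewrite <- csum_scal in E.
      assert (E2 : Cmod (a (S n)) <= (1 - A ^ 2) * Cmod (c (S n)) +
        A * sum_n (fun k => Cmod (a (S k)) * Cmod (c (n - k)%nat)) n).
      { replace (a (S n)) with (- (-1 * a (S n)))%C by ring.
        rewrite Cmod_opp, E. eapply Rle_trans; [apply Cmod_triangle|].
        rewrite !Cmod_mult, Cmod_opp, Cmod_conj, Cmod_R, Rabs_pos_eq by lra.
        fold A. apply Rplus_le_compat_l, Rmult_le_compat_l; auto.
        eapply Rle_trans; [apply Cmod_sum_n|]. apply Req_le, sum_n_ext.
        intros k. apply Cmod_mult. }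
      unfold y at 1.
      apply (Rmult_le_compat_r (r ^ S n)) in E2; [|apply pow_le; lra].
      eapply Rle_trans; [exact E2|]. apply Req_le.
      rewrite Rmult_plus_distr_r. f_equal; [unfold x; ring|].
      rewrite Rmult_assoc. f_equal. rewrite Rmult_comm, <- sum_n_Rmult_l.
      apply sum_n_ext_loc. intros k Hk. unfold x, y.
      replace (r ^ S n) with (r ^ S k * r ^ (n - k)) by (rewrite <- pow_add; f_equal; lia).
      match goal with |- ?a = ?b => change (@eq R a b) end. ring. }
    pose proof (sum_n_le_loc _ _ N (fun n _ => Hy n)) as S1.
    rewrite sum_n_Rplus, !sum_n_Rmult_l in S1.
    pose proof (sum_n_conv_le y x N Y0 X0) as S2.
    pose proof (XN N) as X1. pose proof (XN (S N)) as X2.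
    rewrite sum_n_first_R in X2. pose proof (X0 O) as X3.
    pose proof (sum_n_nonneg y N Y0) as YN.
    fold y. set (Y := sum_n y N) in *.
    set (Z := sum_n (fun n => sum_n (fun k => y k * x (n - k)%nat) n) N) in *.
    set (X := sum_n (fun k => x (S k)) N) in *.
    assert (D : 0 < 1 - A * r) by nra.
    apply Rmult_le_reg_r with (1 - A * r); auto.
    unfold Rdiv. rewrite Rmult_assoc, Rinv_l, Rmult_1_r by lra.
    (* Summation gives [Y <= (1 - A^2) r + A r Y], which is solved for [Y]. *)
    assert (Z <= Y * r).
    { eapply Rle_trans; [exact S2|]. apply Rmult_le_compat_l; auto. }
    assert (A * Z <= A * (Y * r)) by (apply Rmult_le_compat_l; auto).
    assert ((1 - A ^ 2) * X <= (1 - A ^ 2) * r) by (apply Rmult_le_compat_l; lra).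
    lra.
Qed.

(** Comparing coefficients, [(n+1) b_(n+1)] is [q] times the sum of [(j+1) a_(j+1) c_(n-j)]. The
    integer factors drop out since [j <= n], and Bohr's bound for [c] absorbs the convolution. *)
Lemma dilatation_partial_sums (a b c : nat -> C) (q r : R) : 0 <= q -> 0 <= r <= / 3 ->
  (forall n, deriv_coef b n = sum_n (G := C_AbelianMonoid)
     (fun k => RtoC q * deriv_coef a k * c (n - k)%nat)%C n) ->
  (forall n, Cmod (c O) + Cmod (c (S n)) / 2 <= 1) ->
  forall N, sum_n (fun n => Cmod (b (S n)) * r ^ S n) N
    <= q * sum_n (fun n => Cmod (a (S n)) * r ^ S n) N.
Proof.
  intros Hq Hr E Hc N.
  set (y := fun n => Cmod (a (S n)) * r ^ S n). set (x := fun n => Cmod (c n) * r ^ n).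
  assert (Y0 : forall n, 0 <= y n).
  { intros n. apply Rmult_le_pos; [apply Cmod_ge_0|apply pow_le; lra]. }
  assert (X0 : forall n, 0 <= x n).
  { intros n. apply Rmult_le_pos; [apply Cmod_ge_0|apply pow_le; lra]. }
  assert (XN : sum_n x N <= 1).
  { apply (bohr_partial_sums (fun n => Cmod (c n))); auto.
    specialize (Hc O). pose proof (Cmod_ge_0 (c 1%nat)). lra. }
  assert (B : forall n, Cmod (b (S n)) * r ^ S n <= q * sum_n (fun k => y k * x (n - k)%nat) n).
  { intros n.
    assert (Hn : 0 < INR (S n)) by apply lt_0_INR, Nat.lt_0_succ.
    assert (E1 : INR (S n) * Cmod (b (S n)) <=
      INR (S n) * (q * sum_n (fun k => Cmod (a (S k)) * Cmod (c (n - k)%nat)) n)).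
    { replace (INR (S n) * Cmod (b (S n))) with (Cmod (deriv_coef b n)).
      2:{ unfold deriv_coef. rewrite Cmod_mult, Cmod_R, Rabs_pos_eq; lra. }
      rewrite E. eapply Rle_trans; [apply Cmod_sum_n|].
      rewrite <- !sum_n_Rmult_l. apply sum_n_le_loc. intros k Hk.
      unfold deriv_coef. rewrite !Cmod_mult, !Cmod_R, (Rabs_pos_eq q) by auto.
      rewrite Rabs_pos_eq by apply pos_INR.
      assert (INR (S k) <= INR (S n)) by (apply le_INR; lia).
      replace (q * (INR (S k) * Cmod (a (S k))) * Cmod (c (n - k)%nat)) with
        (INR (S k) * (q * (Cmod (a (S k)) * Cmod (c (n - k)%nat)))) by ring.
      apply Rmult_le_compat_r; auto.
      repeat apply Rmult_le_pos; auto; apply Cmod_ge_0. }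
    apply Rmult_le_reg_l in E1; auto.
    apply (Rmult_le_compat_r (r ^ S n)) in E1; [|apply pow_le; lra].
    eapply Rle_trans; [exact E1|]. apply Req_le.
    rewrite Rmult_assoc. f_equal. rewrite Rmult_comm, <- sum_n_Rmult_l.
    apply sum_n_ext_loc. intros k Hk. unfold x, y.
    replace (r ^ S n) with (r ^ S k * r ^ (n - k)) by (rewrite <- pow_add; f_equal; lia).
    match goal with |- ?a = ?b => change (@eq R a b) end. ring. }
  eapply Rle_trans; [apply sum_n_le_loc; intros k _; apply B|].
  rewrite sum_n_Rmult_l. apply Rmult_le_compat_l; auto.
  eapply Rle_trans; [apply sum_n_conv_le; auto|].
  pose proof (sum_n_nonneg y N Y0). nra.
Qed.

(** The quotient considered is [g'/(q h')] with [q > k], because [k] may vanish. *)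
Lemma dilatation_bound (a b : nat -> C) (h g h' g' : C -> C) (k r : R) :
  power_series a h -> power_series b g ->
  (forall z, disk z -> cderiv h z (h' z)) -> (forall z, disk z -> cderiv g z (g' z)) ->
  (forall z, disk z -> h' z <> 0%C) -> 0 <= k ->
  (forall z, disk z -> Cmod (g' z) <= k * Cmod (h' z)) -> 0 <= r <= / 3 ->
  forall N, sum_n (fun n => Cmod (b (S n)) * r ^ S n) N
    <= k * sum_n (fun n => Cmod (a (S n)) * r ^ S n) N.
Proof.
  intros Ha Hb Dh Dg NZ Hk Hle Hr N.
  destruct (power_series_deriv a h Ha) as [h1 [Ph1 Dh1]].
  destruct (power_series_deriv b g Hb) as [g1 [Pg1 Dg1]].
  assert (Eh : forall z, disk z -> h1 z = h' z) by (intros; eapply cderiv_unique; eauto).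
  assert (Eg : forall z, disk z -> g1 z = g' z) by (intros; eapply cderiv_unique; eauto).
  set (S1 := sum_n (fun n => Cmod (b (S n)) * r ^ S n) N).
  set (S2 := sum_n (fun n => Cmod (a (S n)) * r ^ S n) N).
  assert (A : S1 - k * S2 <= 0).
  (* Here [q = k + e]; the excess [e * S2] disappears as [e -> 0]. *)
  { apply Rle_0_of_small with S2. intros e He.
    assert (H : S1 <= (k + e) * S2); [|lra].
    assert (Hq : 0 < k + e) by lra.
    assert (PH : power_series (fun n => RtoC (k + e) * deriv_coef a n)%C
       (fun z => RtoC (k + e) * h1 z)%C).
    { intros z Hz. eapply Cseries_ext; [|apply (Cseries_scal (RtoC (k + e)) _ _ (Ph1 z Hz))].
      intros n. simpl. ring. }
    destruct (bounded_quotient_coefs _ _ _ _ Pg1 PH) as [c [Hc1 [Hc2 _]]].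
    - intros z Hz. rewrite Eh by auto. apply Cmult_neq_0; auto.
      intros E. apply RtoC_inj in E. lra.
    - intros z Hz. rewrite Eh, Eg by auto. rewrite Cmod_mult, Cmod_R, Rabs_pos_eq by lra.
      eapply Rle_trans; [apply Hle; auto|].
      apply Rmult_le_compat_r; [apply Cmod_ge_0|lra].
    - apply (dilatation_partial_sums a b c); auto. lra. }
  lra.
Qed.

(** ** Partial derivatives of [F + conj G] *)

Lemma disk_open (z : C) : disk z -> exists d, 0 < d /\ forall w, Cmod (w - z) < d -> disk w.
Proof.
  intros Hz. exists (1 - Cmod z). unfold disk in *. split; [lra|]. intros w Hw.
  replace w with ((w - z) + z)%C by ring.
  eapply Rle_lt_trans; [apply Cmod_triangle|]. lra.
Qed.

Lemma continuous_C_ext_disk (F G : C -> C) (z : C) : (forall w, disk w -> F w = G w) ->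
  disk z -> @continuous C_UniformSpace C_UniformSpace F z ->
  @continuous C_UniformSpace C_UniformSpace G z.
Proof.
  intros E Hz. apply continuous_ext_loc. apply locally_C_iff.
  destruct (disk_open z Hz) as [d [Hd H]]. exists d; split; auto.
Qed.

Lemma curve_deriv_plus (f g : R -> C) (s : R) (l m : C) :
  curve_deriv f s l -> curve_deriv g s m -> curve_deriv (fun u => f u + g u)%C s (l + m)%C.
Proof.
  intros [H1 H2] [H3 H4]. split.
  - exact (is_derive_plus _ _ _ _ _ H1 H3).
  - exact (is_derive_plus _ _ _ _ _ H2 H4).
Qed.

Lemma curve_deriv_conj (f : R -> C) (s : R) (l : C) :
  curve_deriv f s l -> curve_deriv (fun u => Cconj (f u)) s (Cconj l).
Proof.
  intros [H1 H2]. split; [exact H1|]. exact (is_derive_opp _ _ _ H2).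
Qed.

Lemma curve_deriv_ext_loc (f g : R -> C) (s d : R) (l : C) : 0 < d ->
  (forall u, Rabs (u - s) < d -> f u = g u) -> curve_deriv f s l -> curve_deriv g s l.
Proof.
  intros Hd E [H1 H2].
  assert (L : locally s (fun u => f u = g u)).
  { exists (mkposreal d Hd). intros u Hu. apply E. exact Hu. }
  split; [revert H1|revert H2]; apply is_derive_ext_loc;
    revert L; apply filter_imp; intros u ->; auto.
Qed.

Section HarmonicPartials.
Variables (f F G F1 G1 : C -> C).
Hypothesis f_eq : forall z, disk z -> f z = (F z + Cconj (G z))%C.
Hypothesis F_deriv : forall z, disk z -> cderiv F z (F1 z).
Hypothesis G_deriv : forall z, disk z -> cderiv G z (G1 z).

(** Partial derivatives are derivatives along horizontal and vertical lines, with velocity [m] equal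
    to 1 or [Ci]. The Lipschitz condition keeps the curve in the disk near [s], where the formula
    for [f] is valid. *)
Lemma harmonic_curve_deriv (g : R -> C) (s : R) (m : C) : disk (g s) ->
  (forall u, Cmod (g u - g s) <= Rabs (u - s)) -> curve_deriv g s m ->
  curve_deriv (fun u => f (g u)) s (m * F1 (g s) + Cconj (m * G1 (g s)))%C.
Proof.
  intros Hs Hg Hm. destruct (disk_open _ Hs) as [d [Hd H]].
  apply (curve_deriv_ext_loc (fun u => F (g u) + Cconj (G (g u)))%C _ s d); auto.
  - intros u Hu. symmetry. apply f_eq, H. eapply Rle_lt_trans; [apply Hg|exact Hu].
  - rewrite !(Cmult_comm m). apply curve_deriv_plus.
    + apply (curve_deriv_comp F g); auto.
    + apply curve_deriv_conj, (curve_deriv_comp G g); auto.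
Qed.

Lemma harmonic_partials (z : C) : disk z ->
  ex_partials f z /\ partial_x f z = (F1 z + Cconj (G1 z))%C /\
  partial_y f z = (Ci * F1 z + Cconj (Ci * G1 z))%C.
Proof.
  intros Hz. assert (Ez : (Re z, Im z) = z) by (destruct z; auto).
  pose proof (harmonic_curve_deriv (fun t => (t, Im z)) (Re z) 1) as Dx.
  pose proof (harmonic_curve_deriv (fun t => (Re z, t)) (Im z) Ci) as Dy.
  simpl in Dx, Dy. rewrite Ez in Dx, Dy.
  destruct Dx as [Dx1 Dx2]; auto.
  { intros u. eapply Rle_trans; [apply Cmod_le_parts|]. destruct z as [x y]; simpl.
    replace (y + - y) with 0 by ring. rewrite Rabs_R0. unfold Rminus. lra. }
  { split; simpl; auto_derive; auto. }
  destruct Dy as [Dy1 Dy2]; auto.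
  { intros u. eapply Rle_trans; [apply Cmod_le_parts|]. destruct z as [x y]; simpl.
    replace (x + - x) with 0 by ring. rewrite Rabs_R0. unfold Rminus. lra. }
  { split; simpl; auto_derive; auto. }
  split; [repeat split; eexists; eauto|].
  split; (apply C_ext; simpl; [erewrite is_derive_unique by eassumption
    |erewrite is_derive_unique by eassumption]).
  all: simpl; try ring.
Qed.

Lemma harmonic_C1 :
  (forall z, disk z -> @continuous C_UniformSpace C_UniformSpace F1 z) ->
  (forall z, disk z -> @continuous C_UniformSpace C_UniformSpace G1 z) ->
  C1_on_disk f.
Proof.
  intros CF CG z Hz. split; [apply harmonic_partials, Hz|]. split.
  - apply (continuous_C_ext_disk (fun w => F1 w + Cconj (G1 w))%C); auto.
    + intros w Hw. symmetry. apply harmonic_partials, Hw.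
    + apply continuous_Cplus; auto. apply continuous_Cconj; auto.
  - apply (continuous_C_ext_disk (fun w => Ci * F1 w + Cconj (Ci * G1 w))%C); auto.
    + intros w Hw. symmetry. apply harmonic_partials, Hw.
    + apply continuous_Cplus; [|apply continuous_Cconj];
        (apply continuous_Cmult; [apply continuous_const|auto]).
Qed.

Lemma harmonic_wirtinger (z : C) : disk z ->
  wirtinger_z f z = F1 z /\ wirtinger_zbar f z = Cconj (G1 z).
Proof.
  intros Hz. destruct (harmonic_partials z Hz) as [_ [Ex Ey]].
  unfold wirtinger_z, wirtinger_zbar. rewrite Ex, Ey.
  assert (H2 : RtoC 2 <> 0%C) by (intros E; apply RtoC_inj in E; lra).
  split.
  - transitivity ((2 * F1 z) / 2)%C; [|field; auto]. f_equal.
    apply C_ext; simpl; ring.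
  - transitivity ((2 * Cconj (G1 z)) / 2)%C; [|field; auto]. f_equal.
    apply C_ext; simpl; ring.
Qed.

End HarmonicPartials.

(** The partial derivatives [F1 + conj G1] and [i F1 + conj (i G1)] have the same shape as [f], so
    the first-order results apply to them again; [i^2 = -1] cancels the Laplacian. *)
Lemma harmonic_sum (f F G F1 G1 F2 G2 : C -> C) :
  (forall z, disk z -> f z = (F z + Cconj (G z))%C) ->
  (forall z, disk z -> cderiv F z (F1 z)) -> (forall z, disk z -> cderiv G z (G1 z)) ->
  (forall z, disk z -> cderiv F1 z (F2 z)) -> (forall z, disk z -> cderiv G1 z (G2 z)) ->
  (forall z, disk z -> @continuous C_UniformSpace C_UniformSpace F2 z) ->
  (forall z, disk z -> @continuous C_UniformSpace C_UniformSpace G2 z) ->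
  harmonic_on_disk f.
Proof.
  intros E DF DG DF1 DG1 CF CG.
  pose proof (fun z Hz => proj1 (proj2 (harmonic_partials f F G F1 G1 E DF DG z Hz))) as Ex.
  pose proof (fun z Hz => proj2 (proj2 (harmonic_partials f F G F1 G1 E DF DG z Hz))) as Ey.
  assert (DF1' : forall z, disk z -> cderiv (fun w => Ci * F1 w)%C z (Ci * F2 z)%C)
    by (intros; apply cderiv_scal; auto).
  assert (DG1' : forall z, disk z -> cderiv (fun w => Ci * G1 w)%C z (Ci * G2 z)%C)
    by (intros; apply cderiv_scal; auto).
  split; [split; [|split]|].
  - apply (harmonic_C1 f F G F1 G1); auto; intros z Hz; eapply cderiv_continuous; eauto.
  - apply (harmonic_C1 (partial_x f) F1 G1 F2 G2); auto.
  - apply (harmonic_C1 (partial_y f) _ _ _ _ Ey DF1' DG1');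
      intros z Hz; (apply continuous_Cmult; [apply continuous_const|auto]).
  - intros z Hz. unfold laplacian.
    rewrite (proj1 (proj2 (harmonic_partials (partial_x f) F1 G1 F2 G2 Ex DF1 DG1 z Hz))).
    rewrite (proj2 (proj2 (harmonic_partials (partial_y f) _ _ _ _ Ey DF1' DG1' z Hz))).
    apply C_ext; simpl; ring.
Qed.

(** ** The radius *)

(** Up to a positive factor, the excess over 1 of the sum of the three bounds; see
    [bohr_bound_identity]. *)
Definition bohr_quadratic (a k r : R) : R :=
  (a ^ 2 * (k + 1) + a * k) * r ^ 2 + (k + 2) * (1 + a) * r - 1.

(** Since [k^2 + 12k + 12 - (2k+3)^2 = 3 (1 - k^2)]. Positivity of [a] follows, and with it a
    nonzero denominator of the radius even for [k = 0]. *)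
Lemma alpha_pos (k : R) : 0 <= k < 1 -> 0 < alpha k.
Proof.
  intros Hk. unfold alpha. apply Rdiv_lt_0_compat; [|lra].
  assert (2 * k + 3 < sqrt (k ^ 2 + 12 * k + 12)); [|lra].
  rewrite <- (sqrt_pow2 (2 * k + 3)) by lra. apply sqrt_lt_1; nra.
Qed.

Lemma bohr_radius_spec (a k : R) : 0 <= k < 1 -> alpha k <= a < 1 ->
  0 < bohr_radius a k <= / 3 /\ bohr_quadratic a k (bohr_radius a k) = 0.
Proof.
  intros Hk Ha. pose proof (alpha_pos k Hk) as Hpos.
  (* This is nine times [bohr_quadratic] at [1/3]; times [k + 1] it equals
     [(a (k+1) + 2k + 3)^2 - (k^2 + 12k + 12)]. *)
  assert (Hq : 0 <= a ^ 2 * (k + 1) + a * (4 * k + 6) + 3 * k - 3).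
  { assert (S : sqrt (k ^ 2 + 12 * k + 12) <= a * (k + 1) + (2 * k + 3)).
    { destruct Ha as [Ha _]. unfold alpha in Ha.
      apply (Rmult_le_compat_r (k + 1)) in Ha; [|lra].
      unfold Rdiv in Ha. rewrite Rmult_assoc, Rinv_l, Rmult_1_r in Ha by lra. lra. }
    pose proof (sqrt_pos (k ^ 2 + 12 * k + 12)) as S0.
    assert (S2 : sqrt (k ^ 2 + 12 * k + 12) * sqrt (k ^ 2 + 12 * k + 12) = k ^ 2 + 12 * k + 12)
      by (apply sqrt_sqrt; nra).
    assert (S3 : k ^ 2 + 12 * k + 12 <= (a * (k + 1) + (2 * k + 3)) * (a * (k + 1) + (2 * k + 3)))
      by (rewrite <- S2; apply Rmult_le_compat; auto).
    apply Rmult_le_reg_l with (k + 1); [lra|]. lra. }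
  unfold bohr_quadratic, bohr_radius.
  set (A := a ^ 2 * (k + 1) + a * k). set (b := (k + 2) * (1 + a)).
  replace (2 * a ^ 2 * (k + 1) + 2 * a * k) with (2 * A) by (unfold A; ring).
  assert (HA : 0 < A) by (unfold A; nra).
  assert (Hb : 0 < b) by (unfold b; nra).
  (* [B] is the square root of the discriminant of [A r^2 + b r - 1]. *)
  assert (HB : B a k * B a k = b * b + 4 * A).
  { unfold B. rewrite sqrt_sqrt; [unfold A, b; ring|]. nra. }
  assert (HB0 : 0 <= B a k) by apply sqrt_pos.
  set (r := (B a k - b) / (2 * A)).
  assert (Er : B a k = 2 * A * r + b) by (unfold r; field; lra).
  assert (E0 : A * r ^ 2 + b * r - 1 = 0).
  { rewrite Er in HB. apply Rmult_eq_reg_l with (4 * A); [|lra]. lra. }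
  assert (BB : b < B a k) by nra.
  assert (Hr : 0 < r) by (unfold r; apply Rdiv_lt_0_compat; lra).
  split; auto. split; auto.
  apply Rnot_lt_le. intros H3.
  assert (A * (/ 3 * / 3) + b * / 3 < A * r ^ 2 + b * r).
  { apply Rplus_lt_compat; apply Rmult_lt_compat_l; auto. nra. }
  assert (0 <= A + 3 * b - 9) by (unfold A, b; lra). lra.
Qed.

Lemma bohr_quadratic_incr (a k r s : R) : 0 <= k -> 0 < a -> 0 <= r < s ->
  bohr_quadratic a k r < bohr_quadratic a k s.
Proof.
  intros Hk Ha Hr. unfold bohr_quadratic.
  assert (0 < a ^ 2 * (k + 1) + a * k) by nra.
  assert (r ^ 2 < s ^ 2) by nra.
  assert (0 < (k + 2) * (1 + a)) by nra.
  assert ((k + 2) * (1 + a) * r < (k + 2) * (1 + a) * s) by (apply Rmult_lt_compat_l; lra).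
  assert ((a ^ 2 * (k + 1) + a * k) * r ^ 2 < (a ^ 2 * (k + 1) + a * k) * s ^ 2)
    by (apply Rmult_lt_compat_l; lra).
  lra.
Qed.

(** Both [1 - (a+r)/(1+ar) = (1-a)(1-r)/(1+ar)] and [1 - a^2] contain [1 - a]; what remains over the
    common denominator is quadratic in [r]. *)
Lemma bohr_bound_identity (a k r : R) : 0 <= a < 1 -> 0 <= r < 1 ->
  1 - ((a + r) / (1 + a * r) + (1 + k) * ((1 - a ^ 2) * r / (1 - a * r)))
  = (1 - a) / ((1 + a * r) * (1 - a * r)) * - bohr_quadratic a k r.
Proof.
  intros Ha Hr. unfold bohr_quadratic. assert (0 <= a * r < 1) by nra.
  field. lra.
Qed.

(** * The inequality for the whole class *)

Lemma dilatation_ratio (K k : R) : 1 <= K -> k = (K - 1) / (K + 1) ->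
  0 <= k < 1 /\ K = (1 + k) / (1 - k).
Proof.
  intros HK ->. split; [split|].
  - apply Rdiv_le_0_compat; lra.
  - apply Rmult_lt_reg_r with (K + 1); [lra|]. unfold Rdiv.
    rewrite Rmult_assoc, Rinv_l by lra. lra.
  - field. split; [|lra]. intros E. assert (K + 1 - (K - 1) = 2) by ring. lra.
Qed.

Lemma bohr_inequality (K k : R) (f h g : C -> C) (a_ b_ : nat -> C) (z : C) :
  1 <= K -> k = (K - 1) / (K + 1) -> sense_preserving_qc_harmonic K f h g a_ b_ ->
  (forall w, disk w -> Cmod (h w) < 1) -> alpha k <= Cmod (a_ O) ->
  Cmod z <= bohr_radius (Cmod (a_ O)) k -> bohr_sum h a_ b_ z <= 1.
Proof.
  intros HK Ek [_ [[Ah [Ag [_ Ef]]] [SP [[_ [_ QC]] PS]]]] Hh Ha Hz.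
  set (a := Cmod (a_ O)) in *.
  destruct (dilatation_ratio K k HK Ek) as [Hk EK].
  assert (D0 : disk 0) by (unfold disk; rewrite Cmod_0; lra).
  assert (Ph : power_series a_ h) by (intros w Hw; apply PS, Hw).
  assert (Pg : power_series (fun n => match n with O => 0%C | S _ => b_ n end) g).
  { intros w Hw. replace (g w) with (0 * w ^ 0 + g w)%C by ring.
    apply (Cseries_incr (fun n => match n with O => 0 | S _ => b_ n end * w ^ n)%C).
    apply PS, Hw. }
  assert (E0 : h 0%C = a_ O).
  { apply (Cseries_unique (fun n => a_ n * 0 ^ n)%C); [apply Ph, D0|].
    replace (a_ O) with (a_ O * 0 ^ 0 + 0)%C by (simpl; ring).
    apply (Cseries_incr (fun n => a_ n * 0 ^ n)%C).
    pose proof (Cseries_scal 0 _ _ (Ph 0%C D0)) as S0.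
    replace (RtoC 0) with (0 * h 0%C)%C by ring.
    eapply Cseries_ext; [|exact S0]. intros n. simpl. ring. }
  assert (Ha1 : a < 1) by (unfold a; rewrite <- E0; apply Hh, D0).
  destruct (bohr_radius_spec a k Hk (conj Ha Ha1)) as [Hr Hq].
  set (r := Cmod z) in *.
  assert (Hr0 : 0 <= r) by apply Cmod_ge_0.
  assert (Hr3 : 0 <= r <= / 3) by lra.
  pose proof (alpha_pos k Hk) as Hap.
  assert (Dh : forall w, disk w -> cderiv h w (C_derive h w)).
  { intros w Hw. apply (C_derive_correct h w 0%C). apply Ah, Hw. }
  assert (Dg : forall w, disk w -> cderiv g w (C_derive g w)).
  { intros w Hw. apply (C_derive_correct g w 0%C). apply Ag, Hw. }
  assert (Lt : forall w, disk w -> Cmod (C_derive g w) < Cmod (C_derive h w)).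
  { intros w Hw. specialize (SP w Hw). apply Rsqr_incrst_0; [|apply Cmod_ge_0..].
    rewrite !Rsqr_pow2. lra. }
  destruct (schur_bounds a_ h r Ph Hh Ha1 Hr3) as [B1 B2]. fold a in B1, B2.
  assert (B3 : forall N, sum_n (fun n => Cmod (b_ (S n)) * r ^ S n) N
    <= k * sum_n (fun n => Cmod (a_ (S n)) * r ^ S n) N).
  { apply (dilatation_bound a_ (fun n => match n with O => 0%C | S _ => b_ n end)
      h g (C_derive h) (C_derive g)); auto; try lra.
    - intros w Hw. apply Cmod_gt_0. eapply Rle_lt_trans; [apply Cmod_ge_0|apply Lt, Hw].
    - intros w Hw. specialize (QC w Hw). specialize (Lt w Hw).
      destruct (harmonic_wirtinger f h g _ _ Ef Dh Dg w Hw) as [W1 W2].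
      rewrite W1, W2, Cmod_conj in QC.
      set (p := Cmod (C_derive h w)) in *. set (q := Cmod (C_derive g w)) in *.
      (* Sense preservation makes [p - q] positive; with [K = (1+k)/(1-k)] the distortion bound then
         becomes [q <= k p]. *)
      apply (Rmult_le_compat_r (p - q)) in QC; [|lra].
      unfold Rdiv in QC. rewrite Rmult_assoc, Rinv_l, Rmult_1_r in QC by lra.
      rewrite EK in QC. apply (Rmult_le_compat_r (1 - k)) in QC; [|lra].
      replace ((1 + k) / (1 - k) * (p - q) * (1 - k)) with ((1 + k) * (p - q)) in QC
        by (field; lra).
      lra. }
  set (M := (1 - a ^ 2) * r / (1 - a * r)) in *.
  assert (S1 : Series (fun n => Cmod (a_ (S n)) * r ^ S n) <= M).
  { apply Series_le_of_partial_sums; auto. intros n.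
    apply Rmult_le_pos; [apply Cmod_ge_0|apply pow_le; auto]. }
  assert (S2 : Series (fun n => Cmod (b_ (S n)) * r ^ S n) <= k * M).
  { apply Series_le_of_partial_sums.
    - intros n. apply Rmult_le_pos; [apply Cmod_ge_0|apply pow_le; auto].
    - intros N. eapply Rle_trans; [apply B3|]. apply Rmult_le_compat_l; [lra|auto]. }
  assert (Q : bohr_quadratic a k r <= 0).
  { rewrite <- Hq. destruct (Rle_lt_or_eq_dec _ _ Hz) as [L|L]; [|rewrite L; lra].
    left. apply bohr_quadratic_incr; lra. }
  pose proof (bohr_bound_identity a k r ltac:(lra) ltac:(lra)) as I. fold M in I.
  assert (0 <= (1 - a) / ((1 + a * r) * (1 - a * r)) * - bohr_quadratic a k r).
  { apply Rmult_le_pos; [|lra]. apply Rdiv_le_0_compat; [lra|]. assert (0 <= a * r < 1) by nra. nra. }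
  pose proof (B1 z eq_refl) as B0. unfold bohr_sum. fold r. lra.
Qed.

(** ** Sharpness *)

(** On the segment from [p] to [q], let [s] be the supremum of the parameters with point in [U]. If
    [y s] is in [U], openness forces [s = 1], so [q] lies in both sets; if it is in [V], so are
    nearby points, among them one in [U]. *)
Lemma convex_connected (A : C -> Prop) :
  (forall p q t, 0 <= t <= 1 -> A p -> A q -> A (p + RtoC t * (q - p))%C) ->
  connected_set A.
Proof.
  intros HA U V HU HV Cov [p [Ap Up]] [q [Aq Vq]].
  set (y := fun t : R => (p + RtoC t * (q - p))%C).
  assert (Ay : forall t, 0 <= t <= 1 -> A (y t)) by (intros; apply HA; auto).
  assert (Y0 : y 0 = p) by (unfold y; ring).
  assert (Y1 : y 1 = q) by (unfold y; ring).
  assert (Op : forall W : C -> Prop, @open C_UniformSpace W -> forall s, W (y s) ->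
    exists d, 0 < d /\ forall t, Rabs (t - s) < d -> W (y t)).
  { intros W HW s Ws. apply HW in Ws. apply locally_C_iff in Ws.
    destruct Ws as [d [Hd H]]. pose proof (Cmod_ge_0 (q - p)) as M0.
    exists (d / (Cmod (q - p) + 1)). split; [apply Rdiv_lt_0_compat; lra|].
    intros t Ht. apply H. unfold y.
    replace (p + RtoC t * (q - p) - (p + RtoC s * (q - p)))%C with (RtoC (t - s) * (q - p))%C
      by (rewrite RtoC_minus; ring).
    rewrite Cmod_mult, Cmod_R.
    apply (Rmult_lt_compat_r (Cmod (q - p) + 1)) in Ht; [|lra].
    unfold Rdiv in Ht. rewrite Rmult_assoc, Rinv_l, Rmult_1_r in Ht by lra.
    pose proof (Rabs_pos (t - s)). nra. }
  destruct (completeness (fun t => 0 <= t <= 1 /\ U (y t))) as [s [Hs1 Hs2]].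
  { exists 1. intros t [Ht _]. lra. }
  { exists 0. split; [lra|]. rewrite Y0. auto. }
  assert (S0 : 0 <= s) by (apply Hs1; split; [lra|rewrite Y0; auto]).
  assert (S1 : s <= 1) by (apply Hs2; intros t [Ht _]; lra).
  destruct (Cov (y s) (Ay s (conj S0 S1))) as [Us|Vs].
  - destruct (Rle_lt_or_eq_dec _ _ S1) as [L|L].
    + exfalso. destruct (Op U HU s Us) as [d [Hd H]].
      set (t := Rmin 1 (s + d / 2)).
      assert (s < t) by (unfold t; apply Rmin_glb_lt; lra).
      assert (t <= 1) by apply Rmin_l. assert (t <= s + d / 2) by apply Rmin_r.
      assert (t <= s); [|lra]. apply Hs1. split; [lra|]. apply H.
      rewrite Rabs_pos_eq; lra.
    + exists q. rewrite L, Y1 in Us. auto.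
  - destruct (Op V HV s Vs) as [d [Hd H]].
    assert (E : exists t, (0 <= t <= 1 /\ U (y t)) /\ s - d < t).
    { apply NNPP. intros N.
      assert (s <= s - d); [|lra]. apply Hs2. intros t Ht.
      apply Rnot_lt_le. intros Lt. apply N. exists t. auto. }
    destruct E as [t [[Ht Ut] Lt]].
    exists (y t). split; [apply Ay, Ht|]. split; auto. apply H.
    assert (t <= s) by (apply Hs1; auto). rewrite Rabs_left1; lra.
Qed.

(** Dropping the first term and multiplying by [w] give the same series, so its sum satisfies
    [l - 1 = w l]. *)
Lemma Cseries_geom (w : C) : disk w -> Cseries (fun n => w ^ n)%C (/ (1 - w))%C.
Proof.
  intros Hw.
  destruct (ex_Cseries_abs (fun n => w ^ n)%C (fun n => Cmod w ^ n)) as [l Hl].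
  - intros n. rewrite Cmod_pow. lra.
  - apply ex_series_geom. rewrite Rabs_pos_eq by apply Cmod_ge_0. exact Hw.
  - assert (N : (1 - w)%C <> 0%C).
    { intros E. assert (w = 1%C) as -> by (replace w with (1 - (1 - w))%C by ring; rewrite E; ring).
      unfold disk in Hw. rewrite Cmod_1 in Hw. lra. }
    assert (E : (l - 1 = w * l)%C).
    { apply (Cseries_unique (fun n => w ^ S n)%C).
      - apply (Cseries_decr _ _ Hl).
      - exact (Cseries_scal w _ _ Hl). }
    replace (/ (1 - w))%C with l; auto.
    assert (E' : (l * (1 - w) = 1)%C) by (transitivity (l - w * l)%C; [ring|rewrite <- E; ring]).
    transitivity (l * (1 - w) * / (1 - w))%C; [field; auto|]. rewrite E'. ring.
Qed.

(** * The extremal mapping *)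

Section Extremal.
Variables (a k : R).
Hypothesis a_range : 0 < a < 1.
Hypothesis k_range : 0 <= k < 1.

(** The involutive disk automorphism exchanging 0 and [a]. All its nonconstant coefficients are
    negative. *)
Definition ext_h (z : C) : C := ((RtoC a - z) / (1 - RtoC a * z))%C.
Definition ext_g (z : C) : C := (RtoC k * (ext_h z - RtoC a))%C.
Definition ext_f (z : C) : C := (ext_h z + Cconj (ext_g z))%C.
Definition ext_a (n : nat) : C :=
  match n with O => RtoC a | S m => RtoC (- (1 - a ^ 2) * a ^ m) end.
Definition ext_b (n : nat) : C := (RtoC k * ext_a n)%C.

(** Since [u' = a u^2] and [ext_h = a + (a^2 - 1) z u], the derivatives [h1] and [h2] of [ext_h] are
    multiples of [u^2] and [u^3]. *)
Let u (z : C) : C := (/ (1 - RtoC a * z))%C.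
Let h1 (z : C) : C := (RtoC (a ^ 2 - 1) * (u z * u z))%C.
Let h2 (z : C) : C := (RtoC (2 * a * (a ^ 2 - 1)) * (u z * (u z * u z)))%C.

Lemma ext_denominator (z : C) : disk z -> (1 - RtoC a * z)%C <> 0%C.
Proof.
  intros Hz. apply Cmod_gt_0.
  pose proof (Cmod_triangle_rev 1 (RtoC a * z)) as T.
  rewrite Cmod_1, Cmod_mult, Cmod_R, Rabs_pos_eq in T by lra.
  unfold disk in Hz. pose proof (Cmod_ge_0 z). nra.
Qed.

Lemma ext_u_deriv (z : C) : disk z -> cderiv u z (RtoC a * (u z * u z))%C.
Proof.
  intros Hz. pose proof (ext_denominator z Hz) as N.
  assert (D : cderiv (fun w => 1 - RtoC a * w)%C z (- RtoC a)%C).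
  { apply (cderiv_ext_loc (fun w => 1 + - RtoC a * w)%C).
    { exists 1. split; [lra|]. intros; ring. }
    pose proof (cderiv_plus _ _ z _ _ (cderiv_const 1 z)
      (cderiv_scal (- RtoC a) _ z _ (cderiv_id z))) as D.
    replace (0 + - RtoC a * 1)%C with (- RtoC a)%C in D by ring. exact D. }
  pose proof (cderiv_inv_comp (fun w => 1 - RtoC a * w)%C z _ N D) as P.
  replace (RtoC a * (u z * u z))%C with
    (- - RtoC a / ((1 - RtoC a * z) * (1 - RtoC a * z)))%C; [exact P|].
  unfold u. field. auto.
Qed.

Lemma ext_h_u (z : C) : disk z -> ext_h z = (RtoC a + RtoC (a ^ 2 - 1) * (z * u z))%C.
Proof.
  intros Hz. pose proof (ext_denominator z Hz). unfold ext_h, u.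
  rewrite RtoC_minus, RtoC_pow. field. auto.
Qed.

Lemma ext_h_deriv (z : C) : disk z -> cderiv ext_h z (h1 z).
Proof.
  intros Hz. pose proof (ext_denominator z Hz) as N.
  apply (cderiv_ext_loc (fun w => RtoC a + RtoC (a ^ 2 - 1) * (w * u w))%C).
  { destruct (disk_open z Hz) as [d [Hd H]]. exists d. split; auto.
    intros w Hw. symmetry. apply ext_h_u, H, Hw. }
  replace (h1 z) with (0 + RtoC (a ^ 2 - 1) * (1 * u z + z * (RtoC a * (u z * u z))))%C.
  - apply (cderiv_plus (fun _ => RtoC a)); [apply cderiv_const|].
    apply cderiv_scal. apply (cderiv_mult (fun w => w)); [apply cderiv_id|].
    apply ext_u_deriv, Hz.
  - unfold h1, u. field. auto.
Qed.

Lemma ext_h1_deriv (z : C) : disk z -> cderiv h1 z (h2 z).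
Proof.
  intros Hz. pose proof (ext_u_deriv z Hz) as D.
  replace (h2 z) with (RtoC (a ^ 2 - 1) *
    (RtoC a * (u z * u z) * u z + u z * (RtoC a * (u z * u z))))%C.
  - apply cderiv_scal. apply cderiv_mult; auto.
  - unfold h2. rewrite !RtoC_mult. ring.
Qed.

Lemma ext_h2_continuous (z : C) : disk z -> @continuous C_UniformSpace C_UniformSpace h2 z.
Proof.
  intros Hz. pose proof (ext_u_deriv z Hz) as D. eapply cderiv_continuous.
  apply cderiv_scal. apply cderiv_mult; [exact D|]. apply cderiv_mult; exact D.
Qed.

Lemma ext_g_deriv (z : C) : disk z -> cderiv ext_g z (RtoC k * h1 z)%C.
Proof.
  intros Hz. apply cderiv_scal.
  apply (cderiv_ext_loc (fun w => ext_h w + - RtoC a)%C).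
  { exists 1. split; [lra|]. intros; ring. }
  replace (h1 z) with (h1 z + 0)%C by ring.
  apply (cderiv_plus ext_h); [apply ext_h_deriv, Hz|apply cderiv_const].
Qed.

Lemma ext_h1_neq_0 (z : C) : disk z -> h1 z <> 0%C.
Proof.
  intros Hz. pose proof (ext_denominator z Hz) as N.
  unfold h1, u. repeat apply Cmult_neq_0.
  - intros E. apply RtoC_inj in E. nra.
  - intros E. apply C1_nz. rewrite <- (Cinv_l _ N), E. ring.
  - intros E. apply C1_nz. rewrite <- (Cinv_l _ N), E. ring.
Qed.

Lemma ext_h_disk (z : C) : disk z -> disk (ext_h z).
Proof.
  intros Hz. pose proof (ext_denominator z Hz) as N. unfold disk, ext_h in *.
  rewrite Cmod_div by auto.
  pose proof (proj1 (Cmod_gt_0 _) N) as P.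
  apply Rmult_lt_reg_r with (Cmod (1 - RtoC a * z)); auto.
  unfold Rdiv. rewrite Rmult_assoc, Rinv_l, Rmult_1_r, Rmult_1_l by lra.
  apply Rsqr_incrst_0; [|apply Cmod_ge_0..]. unfold Rsqr. rewrite !Cmod_sqr.
  pose proof (Cmod_sqr z) as S. pose proof (Cmod_ge_0 z).
  assert (0 < (1 - a * a) * (1 - Cmod z * Cmod z)) by (apply Rmult_lt_0_compat; nra).
  rewrite S in *. destruct z; simpl in *. nra.
Qed.

Lemma ext_h_involutive (z : C) : disk z -> ext_h (ext_h z) = z.
Proof.
  intros Hz. pose proof (ext_denominator z Hz) as N.
  pose proof (ext_denominator _ (ext_h_disk z Hz)) as N2. unfold ext_h in *.
  assert (Q : (1 - RtoC a * RtoC a)%C <> 0%C).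
  { rewrite <- RtoC_mult, <- RtoC_minus. intros E. apply RtoC_inj in E. nra. }
  replace (1 - RtoC a * ((RtoC a - z) / (1 - RtoC a * z)))%C with
    ((1 - RtoC a * RtoC a) / (1 - RtoC a * z))%C by (field; auto).
  field. auto.
Qed.

Lemma ext_power_series : power_series_on_disk ext_h ext_g ext_a ext_b.
Proof.
  intros z Hz.
  assert (Hw : disk (RtoC a * z)).
  { unfold disk in *. rewrite Cmod_mult, Cmod_R, Rabs_pos_eq by lra.
    pose proof (Cmod_ge_0 z). nra. }
  assert (S : Cseries (fun n => ext_a (S n) * z ^ S n)%C (ext_h z - RtoC a)%C).
  { rewrite ext_h_u by auto.
    replace (RtoC a + RtoC (a ^ 2 - 1) * (z * u z) - RtoC a)%C
      with (RtoC (a ^ 2 - 1) * z * u z)%C by ring.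
    eapply Cseries_ext; [|apply (Cseries_scal _ _ _ (Cseries_geom _ Hw))].
    intros n. unfold ext_a. rewrite Cpow_mult_l, <- RtoC_pow, Cpow_S, RtoC_mult.
    replace (- (1 - a ^ 2)) with (a ^ 2 - 1) by ring. ring. }
  split.
  - replace (ext_h z) with (ext_a 0 * z ^ 0 + (ext_h z - RtoC a))%C by (simpl; ring).
    apply (Cseries_incr (fun n => ext_a n * z ^ n)%C). exact S.
  - eapply Cseries_ext; [|apply (Cseries_scal (RtoC k) _ _ S)].
    intros n. unfold ext_b. ring.
Qed.

(** The inverse of the real-linear map [y |-> y + k conj y], after a translation. *)
Let tinv (w : C) : C :=
  (RtoC (/ (1 - k ^ 2)) * ((w + RtoC (k * a)) + - RtoC k * Cconj (w + RtoC (k * a))))%C.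

Lemma ext_tinv_f (z : C) : tinv (ext_f z) = ext_h z.
Proof.
  unfold tinv, ext_f, ext_g. set (y := ext_h z).
  apply C_ext; destruct y; simpl; field; nra.
Qed.

Lemma ext_f_tinv (w : C) : (tinv w + Cconj (RtoC k * (tinv w - RtoC a)))%C = w.
Proof. unfold tinv. apply C_ext; destruct w; simpl; field; nra. Qed.

Lemma ext_tinv_continuous (w : C) : @continuous C_UniformSpace C_UniformSpace tinv w.
Proof.
  assert (Ct : @continuous C_UniformSpace C_UniformSpace (fun w => w + RtoC (k * a))%C w).
  { apply continuous_Cplus; [apply continuous_id|apply continuous_const]. }
  apply continuous_Cmult; [apply continuous_const|].
  apply continuous_Cplus; [exact Ct|].
  apply continuous_Cmult; [apply continuous_const|apply continuous_Cconj, Ct].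
Qed.

Lemma ext_tinv_segment (p q : C) (t : R) :
  tinv (p + RtoC t * (q - p))%C = (tinv p + RtoC t * (tinv q - tinv p))%C.
Proof. unfold tinv. apply C_ext; destruct p, q; simpl; ring. Qed.

(** [ext_f] is [ext_h] followed by the invertible real-affine map with inverse [tinv]. Its image is
    thus a preimage of the disk under [tinv], convex and hence connected, and its inverse is [ext_h]
    after [tinv]. *)
Lemma ext_f_homeomorphism :
  exists A, domain A /\ homeomorphism_of_disk_onto ext_f A.
Proof.
  exists (fun w => disk (tinv w)).
  assert (D0 : disk 0) by (unfold disk; rewrite Cmod_0; lra).
  assert (Ch : forall z, disk z -> @continuous C_UniformSpace C_UniformSpace ext_h z)
    by (intros z Hz; eapply cderiv_continuous, ext_h_deriv, Hz).
  assert (Cg : forall z, disk z -> @continuous C_UniformSpace C_UniformSpace ext_g z)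
    by (intros z Hz; eapply cderiv_continuous, ext_g_deriv, Hz).
  split.
  - split; [|split].
    + exists (ext_f 0). rewrite ext_tinv_f. apply ext_h_disk, D0.
    + intros w Hw. destruct (disk_open _ Hw) as [d [Hd H]].
      apply locally_C_iff.
      destruct (proj1 (continuous_C_iff tinv w) (ext_tinv_continuous w) d Hd) as [e [He H']].
      exists e. split; auto.
    + apply convex_connected. intros p q t Ht Hp Hq. rewrite ext_tinv_segment.
      unfold disk in *.
      replace (tinv p + RtoC t * (tinv q - tinv p))%C with
        (RtoC (1 - t) * tinv p + RtoC t * tinv q)%C by (rewrite RtoC_minus; ring).
      eapply Rle_lt_trans; [apply Cmod_triangle|].
      rewrite !Cmod_mult, !Cmod_R, !Rabs_pos_eq by lra.
      pose proof (Cmod_ge_0 (tinv p)). pose proof (Cmod_ge_0 (tinv q)).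
      (* A strict inequality needs a positive weight: that of [p] at [t = 0], that of [q]
         otherwise. *)
      destruct (Req_dec t 0) as [->|]; nra.
  - exists (fun w => ext_h (tinv w)). split.
    + intros z Hz. rewrite ext_tinv_f. split; [apply ext_h_disk, Hz|].
      split; [apply ext_h_involutive, Hz|].
      apply continuous_Cplus; auto. apply continuous_Cconj; auto.
    + intros w Hw. split; [apply ext_h_disk, Hw|]. split.
      * unfold ext_f, ext_g. rewrite ext_h_involutive by exact Hw. apply ext_f_tinv.
      * apply (continuous_comp (V := C_UniformSpace) tinv ext_h);
          [apply ext_tinv_continuous|apply Ch, Hw].
Qed.

(** Since [ext_g' = k ext_h'], the distortion quotient is constant and equal to
    [(1+k)/(1-k) = K]. *)
Lemma ext_class (K : R) : K = (1 + k) / (1 - k) ->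
  sense_preserving_qc_harmonic K ext_f ext_h ext_g ext_a ext_b.
Proof.
  intros EK.
  assert (Ef : forall z, disk z -> ext_f z = (ext_h z + Cconj (ext_g z))%C) by auto.
  assert (Dg1 : forall z, disk z -> cderiv (fun w => RtoC k * h1 w)%C z (RtoC k * h2 z)%C)
    by (intros; apply cderiv_scal, ext_h1_deriv; auto).
  assert (Cg2 : forall z, disk z ->
    @continuous C_UniformSpace C_UniformSpace (fun w => RtoC k * h2 w)%C z)
    by (intros; apply continuous_Cmult; [apply continuous_const|apply ext_h2_continuous; auto]).
  assert (H : harmonic_on_disk ext_f).
  { apply (harmonic_sum ext_f ext_h ext_g h1 _ h2 _ Ef ext_h_deriv ext_g_deriv ext_h1_deriv Dg1
      ext_h2_continuous Cg2). }
  split; [exact H|]. split; [|split; [|split]].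
  - split; [|split; [|split]]; auto.
    + intros z Hz. eexists. apply ext_h_deriv, Hz.
    + intros z Hz. eexists. apply ext_g_deriv, Hz.
    + unfold ext_f, ext_g, ext_h. 
      replace ((RtoC a - 0) / (1 - RtoC a * 0))%C with (RtoC a) by field.
      rewrite Cmult_conj, Cminus_conj. apply C_ext; simpl; ring.
  - intros z Hz.
    rewrite (is_C_derive_unique _ _ _ (ext_h_deriv z Hz)).
    rewrite (is_C_derive_unique _ _ _ (ext_g_deriv z Hz)).
    rewrite Cmod_mult, Cmod_R, Rabs_pos_eq by lra.
    pose proof (proj1 (Cmod_gt_0 _) (ext_h1_neq_0 z Hz)) as P.
    replace (Cmod (h1 z) ^ 2 - (k * Cmod (h1 z)) ^ 2) with (Cmod (h1 z) ^ 2 * (1 - k * k)) by ring.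
    apply Rmult_lt_0_compat; nra.
  - split; [exact ext_f_homeomorphism|]. split; [apply H|].
    intros z Hz.
    destruct (harmonic_wirtinger ext_f ext_h ext_g h1 _ Ef ext_h_deriv ext_g_deriv z Hz)
      as [W1 W2].
    rewrite W1, W2, Cmod_conj, Cmod_mult, Cmod_R, Rabs_pos_eq by lra.
    pose proof (proj1 (Cmod_gt_0 _) (ext_h1_neq_0 z Hz)) as P.
    apply Req_le. rewrite EK. field. split; [lra|].
    assert (0 < Cmod (h1 z) * (1 - k)) by (apply Rmult_lt_0_compat; lra). lra.
  - exact ext_power_series.
Qed.

(** At [z = -r] the value of [ext_h] is the positive number [(a+r)/(1+ar)], and the moduli of the
    coefficients form geometric series of ratio [a r]. *)
Lemma ext_bohr_sum (r : R) : 0 < r < 1 ->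
  bohr_sum ext_h ext_a ext_b (RtoC (- r))
  = (a + r) / (1 + a * r) + (1 + k) * ((1 - a ^ 2) * r / (1 - a * r)).
Proof.
  intros Hr. unfold bohr_sum.
  assert (Har : 0 < a * r < 1) by nra.
  rewrite Cmod_R, Rabs_Ropp, Rabs_pos_eq by lra.
  assert (Eh : Cmod (ext_h (RtoC (- r))) = (a + r) / (1 + a * r)).
  { unfold ext_h. rewrite <- RtoC_mult, <- !RtoC_minus, <- RtoC_div by nra.
    rewrite Cmod_R. replace ((a - - r) / (1 - a * - r)) with ((a + r) / (1 + a * r)) by (field; nra).
    apply Rabs_pos_eq. apply Rdiv_le_0_compat; nra. }
  assert (Sa : is_series (fun n => Cmod (ext_a (S n)) * r ^ S n)
     ((1 - a ^ 2) * r / (1 - a * r))).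
  { pose proof (is_series_scal ((1 - a ^ 2) * r) _ _
      (is_series_geom (a * r) ltac:(rewrite Rabs_pos_eq; lra))) as S.
    eapply is_series_ext; [|exact S]. intros n. unfold ext_a.
    rewrite Cmod_R, Rabs_mult, Rabs_Ropp, !Rabs_pos_eq.
    - rewrite Rpow_mult_distr. change (scal ?x ?y) with (x * y). simpl pow.
      match goal with |- ?x = ?y => change (@eq R x y) end. ring.
    - apply pow_le. lra.
    - nra. }
  assert (Sb : is_series (fun n => Cmod (ext_b (S n)) * r ^ S n)
     (k * ((1 - a ^ 2) * r / (1 - a * r)))).
  { eapply is_series_ext; [|exact (is_series_scal k _ _ Sa)]. intros n. unfold ext_b.
    rewrite Cmod_mult, (Cmod_R k), Rabs_pos_eq by lra.
    change (scal ?x ?y) with (x * y).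
    match goal with |- ?x = ?y => change (@eq R x y) end. ring. }
  rewrite Eh, (is_series_unique _ _ Sa), (is_series_unique _ _ Sb). ring.
Qed.

End Extremal.

Theorem theorem2p9 :
  forall K k : R, 1 <= K -> k = (K - 1) / (K + 1) ->
    (forall (f h g : C -> C) (a_ b_ : nat -> C) (a : R),
        sense_preserving_qc_harmonic K f h g a_ b_ ->
        (forall z : C, disk z -> Cmod (h z) < 1) ->
        a = Cmod (a_ O) ->
        alpha k <= a ->
        forall z : C, Cmod z <= bohr_radius a k -> bohr_sum h a_ b_ z <= 1)
    /\
    (forall a : R, alpha k <= a < 1 ->
      forall r : R, bohr_radius a k < r ->
        ~ (forall (f h g : C -> C) (a_ b_ : nat -> C),
              sense_preserving_qc_harmonic K f h g a_ b_ ->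
              (forall z : C, disk z -> Cmod (h z) < 1) ->
              a = Cmod (a_ O) ->
              forall z : C, disk z -> Cmod z <= r -> bohr_sum h a_ b_ z <= 1)).
Proof.
  intros K k HK Ek. split.
  - intros f h g a_ b_ a Hf Hh -> Ha z Hz.
    eapply bohr_inequality; eauto.
  - intros a Ha r Hr H.
    destruct (dilatation_ratio K k HK Ek) as [Hk EK].
    pose proof (alpha_pos k Hk) as Hp.
    assert (Ha' : 0 < a < 1) by lra.
    destruct (bohr_radius_spec a k Hk Ha) as [R1 R2].
    set (r0 := bohr_radius a k) in *.
    (* A radius beyond [r0], at most [r], and below 1 even if [r] is not. *)
    set (s := Rmin r ((r0 + 1) / 2)).
    assert (s <= r) by apply Rmin_l.
    assert (s <= (r0 + 1) / 2) by apply Rmin_r.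
    assert (r0 < s) by (apply Rmin_glb_lt; lra).
    assert (Es : Cmod (RtoC (- s)) = s) by (rewrite Cmod_R, Rabs_Ropp, Rabs_pos_eq; lra).
    specialize (H _ _ _ _ _ (ext_class a k Ha' Hk K EK) (ext_h_disk a Ha')).
    specialize (H ltac:(simpl; rewrite Cmod_R, Rabs_pos_eq; lra) (RtoC (- s))).
    unfold disk in H. rewrite Es in H. specialize (H ltac:(lra) ltac:(lra)).
    rewrite ext_bohr_sum in H by lra.
    pose proof (bohr_bound_identity a k s ltac:(lra) ltac:(lra)) as I.
    pose proof (bohr_quadratic_incr a k r0 s ltac:(lra) ltac:(lra) ltac:(lra)) as Q.
    assert (Has : 0 < a * s < 1) by nra.
    assert (P : 0 < (1 - a) / ((1 + a * s) * (1 - a * s))) by (apply Rdiv_lt_0_compat; nra).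
    (* The quadratic is positive at [s], so the Bohr sum of the extremal mapping exceeds 1 there. *)
    nra.
Qed.
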